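(* Every conjugacy class of finite subgroups of $\mathrm{PGL}_2(\overline{\mathbb{Q}})$ can be realized as the automorphism group of a map defined over $\mathbb{Q}$; that is, for every finite subgroup $\Gamma\subset\mathrm{PGL}_2(\overline{\mathbb{Q}})$ there is an endomorphism $f:\mathbb{P}^1\to\mathbb{P}^1$ of degree at least $2$ defined over $\mathbb{Q}$ such that $\mathrm{Aut}(f)$ is conjugate to $\Gamma$ in $\mathrm{PGL}_2(\overline{\mathbb{Q}})$.
   Context: For an endomorphism $f$ of $\mathbb{P}^1$, $\mathrm{Aut}(f)=\{\alpha\in\mathrm{PGL}_2(\overline{\mathbb{Q}}):\alpha^{-1}\circ f\circ\alpha=f\}$. *)

(* Defs.v *)
From HB Require Import structures.
From mathcomp Require Import all_boot all_order all_algebra all_field.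
From mathcomp Require Import mpoly.
From mathcomp Require Import boolp classical_sets cardinality.
Set Implicit Arguments.
Unset Strict Implicit.
Unset Printing Implicit Defensive.
Import GRing.Theory.
Local Open Scope ring_scope.
Local Open Scope quotient_scope.

Definition homothetic (K : fieldType) (V : lmodType K) : rel V :=
  fun u v => `[< exists2 c : K, c != 0 & u = c *: v >].

Section Homothetic.
Variables (K : fieldType) (V : lmodType K).

Lemma homotheticP (u v : V) :
  reflect (exists2 c : K, c != 0 & u = c *: v) (homothetic u v).
Proof. exact: asboolP. Qed.

Lemma homothetic_refl : reflexive (@homothetic K V).
Proof. by move=> u; apply/homotheticP; exists 1; rewrite ?oner_neq0 ?scale1r. Qed.

Lemma homothetic_sym : ssrbool.symmetric (@homothetic K V).
Proof.
have sub (u v : V) : homothetic u v -> homothetic v u.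
  case/homotheticP=> c c0 ->; apply/homotheticP; exists c^-1.
    by rewrite invr_eq0.
  by rewrite scalerA mulVf ?scale1r.
by move=> u v; apply/idP/idP; apply: sub.
Qed.

Lemma homothetic_trans : transitive (@homothetic K V).
Proof.
move=> v u w /homotheticP[c c0 ->] /homotheticP[d d0 ->].
by apply/homotheticP; exists (c * d); rewrite ?mulf_neq0 ?scalerA.
Qed.

End Homothetic.

Section ProjectiveLine.
Variable K : fieldType.

Definition nzvec := {v : 'cV[K]_2 | v != 0}.

Definition nzvec_equiv : rel nzvec := fun u v => homothetic (val u) (val v).

Canonical nzvec_equiv_rel :=
  EquivRel nzvec_equiv (fun u => homothetic_refl (val u))
    (fun u v => homothetic_sym (val u) (val v))
    (fun v u w => @homothetic_trans K _ (val v) (val u) (val w)).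

(* A column vector (x, y)^T stands for the point [x : y]. *)
Definition P1 : Type := {eq_quot nzvec_equiv}.
HB.instance Definition _ := EqQuotient.on P1.
HB.instance Definition _ := Choice.on P1.

Lemma P1_eqP (u v : nzvec) :
  reflect (exists2 c : K, c != 0 & val u = c *: val v) (\pi_P1 u == \pi_P1 v).
Proof. by rewrite eqmodE; apply: homotheticP. Qed.

End ProjectiveLine.

Section PGL2.
Variable K : fieldType.

Definition GL2 := {A : 'M[K]_2 | A \in unitmx}.

Definition GL2_equiv : rel GL2 := fun A B => homothetic (val A) (val B).

Canonical GL2_equiv_rel :=
  EquivRel GL2_equiv (fun A => homothetic_refl (val A))
    (fun A B => homothetic_sym (val A) (val B))
    (fun B A C => @homothetic_trans K _ (val B) (val A) (val C)).

Definition PGL2 : Type := {eq_quot GL2_equiv}.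
HB.instance Definition _ := EqQuotient.on PGL2.
HB.instance Definition _ := Choice.on PGL2.

Lemma PGL2_eqP (A B : GL2) :
  reflect (exists2 c : K, c != 0 & val A = c *: val B) (\pi_PGL2 A == \pi_PGL2 B).
Proof. by rewrite eqmodE; apply: homotheticP. Qed.

Definition GL2_one : GL2 := exist _ 1%:M (unitmx1 K 2).

Fact GL2_mul_subproof (A B : GL2) : val A *m val B \in unitmx.
Proof. by rewrite unitmx_mul (valP A) (valP B). Qed.
Definition GL2_mul (A B : GL2) : GL2 := exist (fun M => M \in unitmx) _ (GL2_mul_subproof A B).

Fact GL2_inv_subproof (A : GL2) : invmx (val A) \in unitmx.
Proof. by rewrite unitmx_inv (valP A). Qed.
Definition GL2_inv (A : GL2) : GL2 := exist (fun M => M \in unitmx) _ (GL2_inv_subproof A).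

Definition PGL2_one : PGL2 := \pi_PGL2 GL2_one.
Definition PGL2_mul (a b : PGL2) : PGL2 := \pi_PGL2 (GL2_mul (repr a) (repr b)).
Definition PGL2_inv (a : PGL2) : PGL2 := \pi_PGL2 (GL2_inv (repr a)).

Lemma repr_PGL2 (A : GL2) :
  exists2 c : K, c != 0 & val (repr (\pi_PGL2 A)) = c *: val A.
Proof. by apply/PGL2_eqP; rewrite reprK. Qed.

Lemma PGL2_mul_pi (A B : GL2) :
  PGL2_mul (\pi_PGL2 A) (\pi_PGL2 B) = \pi_PGL2 (GL2_mul A B).
Proof.
have [c c0 eA] := repr_PGL2 A; have [d d0 eB] := repr_PGL2 B.
apply/eqP/PGL2_eqP; exists (c * d); first by rewrite mulf_neq0.
by rewrite /= eA eB -scalemxAl -scalemxAr scalerA.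
Qed.

Lemma PGL2_inv_pi (A : GL2) : PGL2_inv (\pi_PGL2 A) = \pi_PGL2 (GL2_inv A).
Proof.
have [c c0 eA] := repr_PGL2 A.
apply/eqP/PGL2_eqP; exists c^-1; first by rewrite invr_eq0.
by rewrite /= eA invmxZ // -eA (valP (repr (\pi_PGL2 A))).
Qed.

Lemma PGL2_ind (P : PGL2 -> Prop) : (forall A : GL2, P (\pi_PGL2 A)) -> forall a, P a.
Proof. by move=> PA a; rewrite -[a]reprK. Qed.

Fact PGL2_mulA : associative PGL2_mul.
Proof.
elim/PGL2_ind=> A; elim/PGL2_ind=> B; elim/PGL2_ind=> C.
by rewrite !PGL2_mul_pi; congr (\pi_PGL2 _); apply: val_inj; rewrite /= mulmxA.
Qed.

Fact PGL2_mul1g : left_id PGL2_one PGL2_mul.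
Proof.
elim/PGL2_ind=> A.
by rewrite PGL2_mul_pi; congr (\pi_PGL2 _); apply: val_inj; rewrite /= mul1mx.
Qed.

Fact PGL2_mulg1 : right_id PGL2_one PGL2_mul.
Proof.
elim/PGL2_ind=> A.
by rewrite PGL2_mul_pi; congr (\pi_PGL2 _); apply: val_inj; rewrite /= mulmx1.
Qed.

Fact PGL2_mulVg : left_inverse PGL2_one PGL2_inv PGL2_mul.
Proof.
elim/PGL2_ind=> A; rewrite PGL2_inv_pi PGL2_mul_pi.
by congr (\pi_PGL2 _); apply: val_inj; rewrite /= mulVmx ?(valP A).
Qed.

Fact PGL2_mulgV : right_inverse PGL2_one PGL2_inv PGL2_mul.
Proof.
elim/PGL2_ind=> A; rewrite PGL2_inv_pi PGL2_mul_pi.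
by congr (\pi_PGL2 _); apply: val_inj; rewrite /= mulmxV ?(valP A).
Qed.

HB.instance Definition _ := isGroup.Build PGL2
  PGL2_mulA PGL2_mul1g PGL2_mulg1 PGL2_mulVg PGL2_mulgV.

Fact GL2_act_subproof (A : GL2) (v : nzvec K) : val A *m val v != 0.
Proof.
apply: contra (valP v) => /eqP Av0.
by rewrite -[val v](mulKmx (valP A)) Av0 mulmx0.
Qed.
Definition GL2_act (A : GL2) (v : nzvec K) : nzvec K :=
  exist (fun w => w != 0) _ (GL2_act_subproof A v).

(* PGL_2 acting on P^1 by linear fractional transformations. *)
Definition act (a : PGL2) (x : P1 K) : P1 K := \pi_(P1 K) (GL2_act (repr a) (repr x)).

End PGL2.

Lemma repr_P1 (K : fieldType) (v : nzvec K) :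
  exists2 c : K, c != 0 & val (repr (\pi_(P1 K) v)) = c *: val v.
Proof. by apply/P1_eqP; rewrite reprK. Qed.

Lemma act_pi (K : fieldType) (A : GL2 K) (v : nzvec K) :
  act (\pi_(PGL2 K) A) (\pi_(P1 K) v) = \pi_(P1 K) (GL2_act A v).
Proof.
have [c c0 eA] := repr_PGL2 A; have [d d0 ev] := repr_P1 v.
apply/eqP/P1_eqP; exists (c * d); first by rewrite mulf_neq0.
by rewrite /= eA ev -scalemxAl -scalemxAr scalerA.
Qed.

Lemma act1 (K : fieldType) (x : P1 K) : act 1%g x = x.
Proof.
rewrite -[x]reprK act_pi; congr (\pi_(P1 K) _).
by apply: val_inj; rewrite /= mul1mx.
Qed.

Lemma actM (K : fieldType) (a b : PGL2 K) (x : P1 K) :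
  act (a * b)%g x = act a (act b x).
Proof.
elim/PGL2_ind: a => A; elim/PGL2_ind: b => B.
rewrite -[x]reprK [(_ * _)%g]PGL2_mul_pi (act_pi B) !act_pi.
by apply/eqP/P1_eqP; exists 1; rewrite ?oner_neq0 ?scale1r //= mulmxA.
Qed.

(* The evaluation (F_0(x, y), F_1(x, y)) of a pair of binary forms. *)
Definition form_eval (K : fieldType) (F : 'I_2 -> {mpoly K[2]}) (v : 'cV[K]_2)
  : 'cV[K]_2 := \col_i (F i).@[fun j => v j 0].

(* A pair of binary forms of the same degree without common zero; two pairs
   present the same endomorphism of P^1 iff they are proportional.  As the
   forms have no common factor, their degree is that of the endomorphism. *)
Record endoP1 (K : closedFieldType) := EndoP1 {
  degree : nat;
  form : 'I_2 -> {mpoly K[2]};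
  form_homog : forall i, form i \is degree.-homog;
  form_eval_neq0 : forall v : 'cV[K]_2, v != 0 -> form_eval form v != 0
}.

Section Endomorphism.
Variable K : closedFieldType.
Implicit Type f : endoP1 K.

Definition lift_endo f (v : nzvec K) : nzvec K :=
  exist (fun w => w != 0) _ (form_eval_neq0 f (valP v)).

(* K being algebraically closed, an endomorphism of P^1 is determined by its
   effect on K-points. *)
Definition endo_fun f (x : P1 K) : P1 K := \pi_(P1 K) (lift_endo f (repr x)).

Definition defined_over (k : fieldType) (iota : {rmorphism k -> K}) f : Prop :=
  exists (F : 'I_2 -> {mpoly k[2]}) (c : K),
    c != 0 /\ forall i, form f i = c *: map_mpoly iota (F i).

Definition Aut f : set (PGL2 K) :=
  [set a | act a^-1%g \o endo_fun f \o act a = endo_fun f]%classic.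

End Endomorphism.

Lemma meval_dhomogZ (K : fieldType) n d (p : {mpoly K[n]}) c (w : 'I_n -> K) :
  p \is d.-homog -> p.@[fun i => c * w i] = c ^+ d * p.@[w].
Proof.
move=> /dhomogP hp; rewrite !mevalE mulr_sumr; apply: eq_big_seq => m /hp dm.
rewrite mulrCA; congr (_ * _).
under eq_bigr => i _ do rewrite exprMn.
by rewrite big_split /= prodrXr -dm /= mdegE.
Qed.

Lemma endo_fun_pi (K : closedFieldType) (f : endoP1 K) (v : nzvec K) :
  endo_fun f (\pi_(P1 K) v) = \pi_(P1 K) (lift_endo f v).
Proof.
have [c c0 ev] := repr_P1 v.
apply/eqP/P1_eqP; exists (c ^+ degree f); first by rewrite expf_neq0.
apply/matrixP=> i j; rewrite /= !mxE ev -(meval_dhomogZ _ _ (form_homog f i)).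
by apply: meval_eq => k; rewrite mxE.
Qed.

Definition finite_subgroup (G : groupType) (A : set G) : Prop :=
  finite_set A /\ group_closed (mem A).

Definition conjugate (G : groupType) (A B : set G) : Prop :=
  exists g : G, A = [set conjg b g | b in B]%classic.

(* Main.v *)
(** A binary form F with rational coefficients and at least three zeros, all
    simple, yields the map f = [F_y : - F_x], defined over Q.  By Euler's
    identity the fixed points of f are the zeros of F, so an automorphism of f
    permutes these zeros; conversely a projectivity permuting them multiplies F
    by a constant, hence commutes with f.  Thus Aut(f) is the stabilizer of the
    zeros of F.

    Burnside's lemma, applied to the points with nontrivial stabilizer, gives a
    point with stabilizer of order n and orbit of size 1, 2, or 4, 6, 12 with
    n = 3, 4, 5.  Move this point to infinity so that its stabilizer becomes
    the group of z |-> a z with a^n = 1.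
    - In the first two cases the group is cyclic or dihedral; it is Aut(f) for
      f = z^(n+1) + z, resp. f = z^(n+1), as one sees from the points p with
      f^-1(p) = {p}.
    - In the other cases the finite points of the orbit are the roots of a
      polynomial with exponents congruent modulo n, and rescaling turns it into
      z^3 - 1, z^5 - z or z^11 + 11 z^6 - z (for the last one the coefficient
      11 follows from comparing two points of the orbit).  The stabilizer
      of these roots and infinity is not larger than the group: a projectivity
      in it that fixes infinity preserves the barycenter 0 of the roots and
      hence is of the form z |-> a z, with a^n = 1. *)
From HB Require Import structures.
From mathcomp Require Import all_boot all_order all_algebra all_field all_fingroup.
From mathcomp Require Import generic_quotient cyclic mpoly ring zify.
From mathcomp Require Import boolp classical_sets cardinality.
Require Import Defs.
Set Implicit Arguments.
Unset Strict Implicit.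
Unset Printing Implicit Defensive.
Import GRing.Theory Num.Theory.
Local Open Scope ring_scope.
Local Open Scope quotient_scope.

(** * Homogeneous coordinates *)

Section Coordinates.
Variable K : fieldType.
Implicit Types (a b c d x y z : K) (g h : PGL2 K) (p q : P1 K).

Definition vec2 x y : 'cV[K]_2 := \col_i (if i == 0 then x else y).

Definition mx2 a b c d : 'M[K]_2 :=
  \matrix_(i, j) if i == 0 then if j == 0 then a else b
                 else if j == 0 then c else d.

Lemma forall_ord2 (P : 'I_2 -> Prop) : P 0 -> P 1 -> forall i, P i.
Proof.
move=> P0 P1 [[|[|//]] ilt].
  by rewrite (_ : Ordinal _ = 0) //; apply: val_inj.
by rewrite (_ : Ordinal _ = 1) //; apply: val_inj.
Qed.

Lemma vec2_eta (v : 'cV[K]_2) : v = vec2 (v 0 0) (v 1 0).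
Proof. by apply/colP; apply: forall_ord2; rewrite !mxE. Qed.

Lemma mx2_eta (A : 'M[K]_2) : A = mx2 (A 0 0) (A 0 1) (A 1 0) (A 1 1).
Proof.
by apply/matrixP; apply: forall_ord2; apply: forall_ord2; rewrite !mxE.
Qed.

Lemma vec2_eq0 x y : (vec2 x y == 0) = (x == 0) && (y == 0).
Proof.
apply/eqP/andP => [/colP e|[/eqP-> /eqP->]].
  by move: (e 0) (e 1); rewrite !mxE /= => -> ->.
by apply/colP => i; rewrite !mxE if_same.
Qed.

Lemma vec2_inj x y x' y' : vec2 x y = vec2 x' y' -> x = x' /\ y = y'.
Proof. by move=> /colP e; move: (e 0) (e 1); rewrite !mxE. Qed.

Lemma scale_vec2 c x y : c *: vec2 x y = vec2 (c * x) (c * y).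
Proof. by apply/colP; apply: forall_ord2; rewrite !mxE. Qed.

Lemma scale_mx2 k a b c d : k *: mx2 a b c d = mx2 (k * a) (k * b) (k * c) (k * d).
Proof.
by apply/matrixP; apply: forall_ord2; apply: forall_ord2; rewrite !mxE.
Qed.

Lemma mx2_inj a b c d a' b' c' d' :
  mx2 a b c d = mx2 a' b' c' d' -> [/\ a = a', b = b', c = c' & d = d'].
Proof.
move=> /matrixP e; move: (e 0 0) (e 0 1) (e 1 0) (e 1 1).
by rewrite !mxE /= => -> -> -> ->.
Qed.

Lemma sum_ord2 (V : zmodType) (F : 'I_2 -> V) : \sum_i F i = F 0 + F 1.
Proof.
by rewrite big_ord_recl big_ord1; congr (_ + F _); apply: val_inj.
Qed.

Lemma mul_mx2_vec2 a b c d x y :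
  mx2 a b c d *m vec2 x y = vec2 (a * x + b * y) (c * x + d * y).
Proof. by apply/colP; apply: forall_ord2; rewrite !mxE sum_ord2 !mxE. Qed.

Lemma mul_mx2 a b c d a' b' c' d' :
  mx2 a b c d *m mx2 a' b' c' d' =
  mx2 (a * a' + b * c') (a * b' + b * d') (c * a' + d * c') (c * b' + d * d').
Proof.
by apply/matrixP; apply: forall_ord2; apply: forall_ord2;
   rewrite !mxE sum_ord2 !mxE.
Qed.

Lemma unitmx2 a b c d : (mx2 a b c d \in unitmx) = (a * d - b * c != 0).
Proof.
rewrite unitmxE unitfE (expand_det_row _ 0) sum_ord2 /cofactor !det_mx11 !mxE /=.
by rewrite expr0 expr1 mul1r mulN1r mulrN.
Qed.

Fact nzvec_inf_subproof : vec2 1 0 != 0.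
Proof. by rewrite vec2_eq0 oner_eq0. Qed.
Definition nzvec_inf : nzvec K := exist (fun v => v != 0) _ nzvec_inf_subproof.

(* The point [x : y]; junk value [1 : 0] when x = y = 0. *)
Definition pt x y : P1 K := \pi_(P1 K) (insubd nzvec_inf (vec2 x y)).

(* The class of the matrix (a b; c d); junk value 1 when it is singular. *)
Definition mob a b c d : PGL2 K := \pi_(PGL2 K) (insubd (GL2_one K) (mx2 a b c d)).

Notation inf := (pt 1 0).

Lemma ptE (v : nzvec K) : \pi_(P1 K) v = pt (val v 0 0) (val v 1 0).
Proof. by rewrite /pt -vec2_eta valKd. Qed.

Lemma mobE (A : GL2 K) :
  \pi_(PGL2 K) A = mob (val A 0 0) (val A 0 1) (val A 1 0) (val A 1 1).
Proof. by rewrite /mob -mx2_eta valKd. Qed.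

Lemma pt_ind (P : P1 K -> Prop) :
  (forall x y, (x != 0) || (y != 0) -> P (pt x y)) -> forall p, P p.
Proof.
move=> H p; rewrite -[p]reprK ptE; apply: H.
by rewrite -negb_and -vec2_eq0 -vec2_eta (valP (repr p)).
Qed.

Lemma mob_ind (P : PGL2 K -> Prop) :
  (forall a b c d, a * d - b * c != 0 -> P (mob a b c d)) -> forall g, P g.
Proof.
move=> H g; rewrite -[g]reprK mobE; apply: H.
by rewrite -unitmx2 -mx2_eta (valP (repr g)).
Qed.

Lemma pt_eqE x y x' y' : (x != 0) || (y != 0) -> (x' != 0) || (y' != 0) ->
  (pt x y == pt x' y') = (x * y' == x' * y).
Proof.
rewrite -!negb_and -!vec2_eq0 /pt => v0 w0; apply/eqP/eqP.
  move=> e; have [c c0] := P1_eqP _ _ (introT eqP e).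
  by rewrite !insubdK // scale_vec2 => /vec2_inj[-> ->]; ring.
move=> e; apply/eqP; apply: (introT (P1_eqP _ _)); rewrite !insubdK //.
move: v0 w0; rewrite !vec2_eq0 !negb_and.
case: (eqVneq x 0) e => [->|x0] e; last first.
  move=> _; case: (eqVneq x' 0) e => [->|x0'] e.
    move=> /= y0'; move/eqP: e; rewrite mul0r mulf_eq0 (negPf x0) => /eqP e.
    by rewrite e eqxx in y0'.
  move=> _; exists (x / x'); first by rewrite mulf_neq0 ?invr_eq0.
  by rewrite scale_vec2 divfK // mulrAC e mulrAC divff // mul1r.
move=> /= y0 w0; move/eqP: e; rewrite mul0r eq_sym mulf_eq0 (negPf y0) orbF => /eqP e.
rewrite e eqxx /= in w0 *; exists (y / y'); first by rewrite mulf_neq0 ?invr_eq0.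
by rewrite scale_vec2 divfK // mulr0.
Qed.

Lemma ptZ c x y : c != 0 -> pt (c * x) (c * y) = pt x y.
Proof.
move=> c0; have [/andP[/eqP-> /eqP->]|] := boolP ((x == 0) && (y == 0)).
  by rewrite mulr0.
rewrite negb_and => v0; apply/eqP; rewrite pt_eqE ?mulf_eq0 ?(negPf c0) //.
by rewrite -!mulrA [x * (c * y)]mulrCA.
Qed.

Lemma pt_inf x : x != 0 -> pt x 0 = inf.
Proof. by move=> x0; rewrite -[in LHS](mulr1 x) -[in LHS](mulr0 x) ptZ. Qed.

Lemma pt_aff x y : y != 0 -> pt x y = pt (x / y) 1.
Proof. by move=> y0; rewrite -[in RHS](ptZ _ _ y0) mulrC divfK // mulr1. Qed.

Lemma nz10 : ((1 : K) != 0) || ((0 : K) != 0).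
Proof. by rewrite oner_neq0. Qed.

Lemma nz01 x : (x != 0) || ((1 : K) != 0).
Proof. by rewrite oner_neq0 orbT. Qed.

Lemma pt_inj : injective (pt^~ 1).
Proof. by move=> x y /eqP; rewrite pt_eqE ?oner_neq0 ?orbT // !mulr1 => /eqP. Qed.

Lemma pt_neq_inf x : pt x 1 <> inf.
Proof.
by move/eqP; rewrite pt_eqE ?oner_neq0 ?orbT // mulr0 mul1r eq_sym oner_eq0.
Qed.

Variant point_spec : P1 K -> Type :=
  | PointInf : point_spec inf
  | PointAff x : point_spec (pt x 1).

Lemma pointP p : point_spec p.
Proof.
(* [point_spec] lives in [Type], so the affine coordinate is extracted from a propositional
   existence by the choice operator [xget]. *)
suff e : p = if `[< p = inf >] then inf else pt (xget 0 [set x | p = pt x 1]%classic) 1.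
  by rewrite e; case: ifP => _; constructor.
case: asboolP => // np.
suff [x ex] : exists x, p = pt x 1 by apply: (@xgetPex _ 0 [set x | p = pt x 1]%classic);
  exists x.
elim/pt_ind: p np => x y; have [->|y0 _ _] := eqVneq y 0.
  by rewrite orbF => x0; rewrite pt_inf.
by exists (x / y); apply: pt_aff.
Qed.

Lemma point_cases p : p = inf \/ exists x, p = pt x 1.
Proof. by case: (pointP p) => [|x]; [left | right; exists x]. Qed.

Lemma act_mob a b c d x y : a * d - b * c != 0 -> (x != 0) || (y != 0) ->
  act (mob a b c d) (pt x y) = pt (a * x + b * y) (c * x + d * y).
Proof.
rewrite -unitmx2 -negb_and -vec2_eq0 => u v0; rewrite act_pi.
rewrite [RHS]/pt -mul_mx2_vec2; congr (\pi_(P1 K) _).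
have w0 : mx2 a b c d *m vec2 x y != 0.
  apply: contra v0 => /eqP Av0.
  by rewrite -[vec2 x y](mulKmx u) Av0 mulmx0.
by apply: val_inj; rewrite /= !insubdK.
Qed.

Lemma mob_mul a b c d a' b' c' d' :
  a * d - b * c != 0 -> a' * d' - b' * c' != 0 ->
  (mob a b c d * mob a' b' c' d')%g =
  mob (a * a' + b * c') (a * b' + b * d') (c * a' + d * c') (c * b' + d * d').
Proof.
rewrite -!unitmx2 => u u'; rewrite [LHS]PGL2_mul_pi [RHS]/mob -mul_mx2.
have w : mx2 a b c d *m mx2 a' b' c' d' \in unitmx by rewrite unitmx_mul u.
by congr (\pi_(PGL2 K) _); apply: val_inj; rewrite /= !insubdK.
Qed.

Lemma mob1 : mob 1 0 0 1 = 1%g.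
Proof.
have e : insubd (GL2_one K) (mx2 1 0 0 1) = GL2_one K.
  apply: val_inj; rewrite val_insubd unitmx2 mulr1 mulr0 subr0 oner_neq0 /=.
  by rewrite [RHS]mx2_eta !mxE.
by rewrite /mob e.
Qed.

Lemma mob_eqP a b c d a' b' c' d' :
  a * d - b * c != 0 -> a' * d' - b' * c' != 0 ->
  reflect (exists2 k, k != 0 & [/\ a = k * a', b = k * b', c = k * c' & d = k * d'])
    (mob a b c d == mob a' b' c' d').
Proof.
rewrite -!unitmx2 => u u'; apply: (iffP (PGL2_eqP _ _)) => -[k k0].
  by rewrite !val_insubd u u' scale_mx2 => /mx2_inj[-> -> -> ->]; exists k.
move=> [-> -> -> ->]; exists k => //; rewrite -scale_mx2 !val_insubd u'.
by rewrite unitmxZ ?unitfE // u'.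
Qed.

Lemma actK g : cancel (act g) (act g^-1%g).
Proof. by move=> p; rewrite -actM mulVg act1. Qed.

Lemma actKV g : cancel (act g^-1%g) (act g).
Proof. by move=> p; rewrite -actM mulgV act1. Qed.

Lemma act_inj g : injective (act g).
Proof. exact: can_inj (actK g). Qed.

Definition aff a b := mob a b 0 1.

Lemma aff_det a b : a != 0 -> a * 1 - b * 0 != 0.
Proof. by rewrite mulr1 mulr0 subr0. Qed.

Lemma act_aff a b x : a != 0 -> act (aff a b) (pt x 1) = pt (a * x + b) 1.
Proof.
move=> a0; rewrite act_mob ?aff_det ?oner_neq0 ?orbT //.
by rewrite !mulr1 mul0r add0r.
Qed.

Lemma act_aff_inf a b : a != 0 -> act (aff a b) inf = inf.
Proof.
by move=> a0; rewrite act_mob ?aff_det ?oner_neq0 // !mulr0 mul0r !addr0 mulr1 pt_inf.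
Qed.

Lemma aff_mul a b a' b' : a != 0 -> a' != 0 ->
  (aff a b * aff a' b')%g = aff (a * a') (a * b' + b).
Proof.
by move=> a0 a0'; rewrite mob_mul ?aff_det // !mulr0 !mul0r mulr1 !addr0 mulr1 add0r.
Qed.

Lemma aff1 : aff 1 0 = 1%g. Proof. exact: mob1. Qed.

Lemma affV a b : a != 0 -> (aff a b)^-1%g = aff a^-1 (- (b / a)).
Proof.
move=> a0; apply: (mulgI (aff a b)); rewrite mulgV aff_mul ?invr_eq0 // divff //.
by rewrite mulrN mulrCA divff // mulr1 addNr aff1.
Qed.

Lemma aff_inj a b a' b' : a != 0 -> a' != 0 -> aff a b = aff a' b' -> a = a' /\ b = b'.
Proof.
move=> a0 a0' /eqP/mob_eqP; rewrite !aff_det // => /(_ isT isT)[k k0].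
by case=> -> -> _; rewrite mulr1 => <-; rewrite !mul1r.
Qed.

Lemma fix_infP g : act g inf = inf -> exists a b, a != 0 /\ g = aff a b.
Proof.
elim/mob_ind: g => a b c d D; rewrite act_mob ?oner_neq0 // !mulr1 !mulr0 !addr0.
have ac : (a != 0) || (c != 0).
  rewrite -negb_and; apply: contra D => /andP[/eqP-> /eqP->].
  by rewrite mul0r mulr0 subr0.
move/eqP; rewrite pt_eqE ?oner_neq0 // mulr0 mul1r => /eqP c0.
rewrite -c0 mulr0 subr0 mulf_eq0 negb_or in D; case/andP: D => a0 d0.
exists (a / d), (b / d); split; first by rewrite mulf_neq0 ?invr_eq0.
apply/eqP/mob_eqP; rewrite ?aff_det ?mulf_neq0 ?invr_eq0 //.
  by rewrite -c0 mulr0 subr0 mulf_neq0.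
by exists d => //; rewrite !(mulrC d) !divfK // -c0 mul0r mul1r.
Qed.

Lemma fix_inf_0P g : act g inf = inf -> act g (pt 0 1) = pt 0 1 ->
  exists2 a, a != 0 & g = aff a 0.
Proof.
move=> /fix_infP[a [b [a0 ->]]]; rewrite act_aff // mulr0 add0r => /pt_inj ->.
by exists a.
Qed.

(** Coordinates of p and q serve as the columns of the matrix; the determinant is nonzero because
    the points differ. *)
Lemma trans2 p q : p <> q -> exists2 h, act h inf = p & act h (pt 0 1) = q.
Proof.
elim/pt_ind: p => x y v0; elim/pt_ind: q => x' y' w0 pq.
have D : x * y' - x' * y != 0.
  by rewrite subr_eq0 -pt_eqE //; apply/eqP.
exists (mob x x' y y'); rewrite act_mob ?oner_neq0 ?orbT //.
  by rewrite !mulr1 !mulr0 !addr0.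
by rewrite !mulr1 !mulr0 !add0r.
Qed.

Definition swap := mob 0 1 1 0.

Lemma swap_det : (0 : K) * 0 - 1 * 1 != 0.
Proof. by rewrite mulr0 mulr1 sub0r oppr_eq0 oner_neq0. Qed.

Lemma act_swap x y : (x != 0) || (y != 0) -> act swap (pt x y) = pt y x.
Proof.
by move=> v0; rewrite act_mob ?swap_det // !mul0r !mul1r add0r addr0.
Qed.

Lemma swapK : (swap * swap = 1)%g.
Proof.
by rewrite mob_mul ?swap_det // !mulr0 !mulr1 !addr0 add0r mob1.
Qed.

Lemma swap_aff a : a != 0 -> (swap * aff a 0 = aff a^-1 0 * swap)%g.
Proof.
move=> a0; rewrite !mob_mul ?swap_det ?aff_det ?invr_eq0 //; apply/eqP.
rewrite !mulr0 !mul0r !mulr1 !mul1r !addr0 !add0r.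
apply/mob_eqP; rewrite ?mul0r ?mulr0 ?sub0r ?mul1r ?mulr1 ?oppr_eq0 ?invr_eq0 //.
by exists a => //; rewrite !mulr0 mulr1 divff.
Qed.

End Coordinates.
Notation inf := (pt 1 0).

(** * Automorphisms and derivatives of forms *)

Section Endomorphisms.
Variable K : closedFieldType.
Implicit Types (f : endoP1 K) (g h : PGL2 K) (p q : P1 K) (x y : K).

Definition coord x y : 'I_2 -> K := fun i => if i == 0 then x else y.

Lemma form_eval_vec2 (F : 'I_2 -> {mpoly K[2]}) x y :
  form_eval F (vec2 x y) = vec2 (F 0).@[coord x y] (F 1).@[coord x y].
Proof.
by apply/colP; apply: forall_ord2; rewrite !mxE; apply: meval_eq => i; rewrite !mxE.
Qed.

Lemma endo_fun_pt f x y : (x != 0) || (y != 0) ->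
  endo_fun f (pt x y) = pt (form f 0).@[coord x y] (form f 1).@[coord x y].
Proof.
rewrite -negb_and -vec2_eq0 => v0; rewrite [in LHS]/pt endo_fun_pi.
rewrite /pt; congr (\pi_(P1 K) _); apply: val_inj.
rewrite -form_eval_vec2 /= insubdK // insubdK //.
exact: (form_eval_neq0 f v0).
Qed.

Lemma AutP f g : Aut f g <-> forall p, endo_fun f (act g p) = act g (endo_fun f p).
Proof.
split=> [e p|e]; last by apply/funext => p /=; rewrite e actK.
by rewrite -[in RHS]e /= actKV.
Qed.

Lemma AutM f g h : Aut f g -> Aut f h -> Aut f (g * h)%g.
Proof. by move=> /AutP eg /AutP eh; apply/AutP => p; rewrite !actM eg eh. Qed.

Lemma AutV f g : Aut f g -> Aut f g^-1%g.
Proof.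
by move=> /AutP eg; apply/AutP => p; apply: (@act_inj _ g); rewrite -eg !actKV.
Qed.

Definition fixed f p := endo_fun f p = p.

Lemma fixed_Aut f g p : Aut f g -> fixed f p -> fixed f (act g p).
Proof. by move=> /AutP eg fp; rewrite /fixed eg fp. Qed.

(** Every automorphism of f permutes these points; for the power maps below this pins down infinity,
    and 0 as well when e = 0. *)
Definition exceptional f p := forall q, endo_fun f q = p -> q = p.

Lemma exceptional_Aut f g p :
  Aut f g -> exceptional f p -> exceptional f (act g p).
Proof.
move=> /AutV/AutP eg fp q fq.
by apply: (@act_inj _ g^-1%g); rewrite actK; apply: fp; rewrite eg fq actK.
Qed.

(** If the difference r vanishes everywhere, then r + 1 has no root, hence is constant over an
    algebraically closed field. *)
Lemma poly_ext (p q : {poly K}) : (forall t, p.[t] = q.[t]) -> p = q.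
Proof.
move=> e; apply/eqP; rewrite -subr_eq0; apply/eqP; set r := p - q.
have r0 t : r.[t] = 0 by rewrite hornerD hornerN e subrr.
have [s1|sn1] := eqVneq (size (r + 1)) 1%N; last first.
  have [t] := closed_rootP _ sn1.
  by rewrite rootE hornerD r0 add0r hornerC oner_eq0.
have [c c0 ec] := size_poly1P _ (introT eqP s1).
by move: (r0 0); rewrite (_ : r = (c - 1)%:P) ?hornerC => [->|] //;
  rewrite polyCB -ec addrK.
Qed.

Section LineDerivative.
Variables (n : nat) (v w : 'I_n -> K).

(** The restriction of F to the line t |-> v + t w. It reduces the chain rule and Euler's identity
    to polynomials in one variable. *)
Definition line_poly : {mpoly K[n]} -> {poly K} :=
  mmap polyC (fun i => (v i)%:P + w i *: 'X).

Lemma line_poly_eval F t : (line_poly F).[t] = F.@[fun i => v i + t * w i].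
Proof.
rewrite /line_poly /mmap mevalE horner_sum; apply: eq_bigr => m _.
rewrite hornerM hornerC; congr (_ * _); rewrite horner_prod; apply: eq_bigr => i _.
by rewrite horner_exp hornerD hornerC hornerZ hornerX mulrC.
Qed.

(** Both sides are linear in F and obey the product rule, so the variables suffice. *)
Lemma line_poly_deriv F :
  (line_poly F)^`().[0] = \sum_i F^`M(i).@[v] * w i.
Proof.
have L0 G : (line_poly G).[0] = G.@[v].
  by rewrite line_poly_eval; apply: meval_eq => i; rewrite mul0r addr0.
pose Q G := (line_poly G)^`().[0] = \sum_i G^`M(i).@[v] * w i.
have QM G H : Q G -> Q H -> Q (G * H).
  rewrite /Q => QG QH; rewrite /line_poly rmorphM -!/(line_poly _) derivM hornerD !hornerM.
  rewrite QG QH !L0 mulr_suml mulr_sumr -big_split; apply: eq_bigr => i _ /=.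
  rewrite mderivM mevalD !mevalM; ring.
have Q1 : Q 1.
  rewrite /Q /line_poly rmorph1 derivC horner0 big1 // => i _.
  by rewrite -mpolyC1 mderivC meval0 mul0r.
have QX i : Q 'X_i.
  rewrite /Q /line_poly mmapX mmap1U derivD derivC add0r derivZ derivX hornerZ hornerC
    mulr1.
  rewrite (bigD1 i) //= big1 ?addr0 => [|j ji].
    by rewrite mderivX mnm1E eqxx -{1}[U_(i)%MM]add0m addmK mpolyX0 mevalZ meval1 !mul1r.
  by rewrite mderivX mnm1E eq_sym (negPf ji) scale0r meval0 mul0r.
rewrite -/(Q F) [F]mpolyE; apply: (big_ind Q).
- rewrite /Q /line_poly rmorph0 deriv0 horner0 big1 // => i _.
  by rewrite mderiv0 meval0 mul0r.
- move=> G H QG QH; rewrite /Q /line_poly rmorphD derivD hornerD -!/(line_poly _).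
  rewrite QG QH -big_split; apply: eq_bigr => i _ /=.
  by rewrite mderivD mevalD mulrDl.
move=> m _; rewrite /Q /line_poly mmapZ derivM derivC mul0r add0r hornerM hornerC
  -/(line_poly _).
transitivity (F@_m * (\sum_i 'X_[m]^`M(i).@[v] * w i)).
  congr (_ * _); rewrite mpolyXE_id; apply: (big_ind Q) => // i _.
  by elim: (m i) => [|k IHk]; rewrite ?expr0 ?exprS //; apply: QM.
by rewrite mulr_sumr; apply: eq_bigr => i _; rewrite mderivZ mevalZ mulrA.
Qed.

End LineDerivative.

Lemma line_poly_deriv2 x y s t (F : {mpoly K[2]}) :
  (line_poly (coord x y) (coord s t) F)^`().[0] =
  F^`M(0).@[coord x y] * s + F^`M(1).@[coord x y] * t.
Proof. by rewrite line_poly_deriv sum_ord2. Qed.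

Lemma line_poly_eval2 x y s t (F : {mpoly K[2]}) u :
  (line_poly (coord x y) (coord s t) F).[u] = F.@[coord (x + u * s) (y + u * t)].
Proof.
by rewrite line_poly_eval; apply: meval_eq => i; rewrite /coord; case: ifP.
Qed.

(** The chain rule for F(g v) = k F(v), read off along the two coordinate directions. *)
Lemma mderiv_invariant (F : {mpoly K[2]}) a b c d k :
  (forall x y, F.@[coord (a * x + b * y) (c * x + d * y)] = k * F.@[coord x y]) ->
  forall x y, let x' := a * x + b * y in let y' := c * x + d * y in
    a * F^`M(0).@[coord x' y'] + c * F^`M(1).@[coord x' y'] = k * F^`M(0).@[coord x y]
 /\ b * F^`M(0).@[coord x' y'] + d * F^`M(1).@[coord x' y'] = k * F^`M(1).@[coord x y].
Proof.
move=> inv x y x' y'.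
have e s t : line_poly (coord x' y') (coord (a * s + b * t) (c * s + d * t)) F =
    k *: line_poly (coord x y) (coord s t) F.
  apply: poly_ext => u; rewrite hornerZ !line_poly_eval2 -inv.
  by congr (meval (coord _ _) _); rewrite /x' /y'; ring.
have {}e s t := congr1 (fun p : {poly K} => p^`().[0]) (e s t).
move: (e 1 0) (e 0 1); rewrite /= !derivZ !hornerZ !line_poly_deriv2.
rewrite !mulr0 !mulr1 !addr0 !add0r => <- <-.
by split; rewrite addrC mulrC [X in _ + X]mulrC addrC.
Qed.

End Endomorphisms.

(** * The map attached to a binary form *)

(** An injection of a finite set into itself is a permutation; this form reindexes sums and products
    over zeros. *)
Lemma mem_uniq_perm_eq (T : choiceType) (h : T -> T) (s : seq T) :
  injective h -> uniq s -> {in s, forall x, h x \in s} -> perm_eq [seq h x | x <- s] s.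
Proof.
move=> hI us hs; have us' : uniq [seq h x | x <- s] by rewrite map_inj_uniq.
have sub : {subset [seq h x | x <- s] <= s} by move=> _ /mapP[x xs ->]; apply: hs.
have [_ e] := uniq_min_size us' sub (eq_leq (esym (size_map _ _))).
exact: uniq_perm.
Qed.

Lemma dhomog_mderiv (K : fieldType) n d (F : {mpoly K[n]}) i :
  F \is d.+1.-homog -> F^`M(i) \is d.-homog.
Proof.
move=> /dhomogP hF; apply/dhomogP => m; rewrite mcoeff_msupp mcoeff_mderiv => c0.
have : (m + U_(i))%MM \in msupp F.
  by rewrite mcoeff_msupp; apply: contra c0 => /eqP->; rewrite mul0rn.
by move/hF; rewrite /= mdegD mdeg1 addn1 => -[].
Qed.

Section Wedge.
Variable K : fieldType.
Implicit Types (p q : P1 K) (x y : K) (g : PGL2 K).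

Definition xcoord p : K := val (repr p) 0 0.
Definition ycoord p : K := val (repr p) 1 0.

Lemma pt_coords p : pt (xcoord p) (ycoord p) = p.
Proof. by rewrite -ptE reprK. Qed.

Lemma coords_neq0 p : (xcoord p != 0) || (ycoord p != 0).
Proof. by rewrite -negb_and -vec2_eq0 -vec2_eta (valP (repr p)). Qed.

(** The determinant of (x, y) and the chosen coordinates of p, that is, a linear form whose only
    zero is p. *)
Definition wedge x y p := x * ycoord p - y * xcoord p.

Lemma wedge_eq0 x y p : (x != 0) || (y != 0) -> (wedge x y p == 0) = (pt x y == p).
Proof.
move=> v0; rewrite -[in RHS](pt_coords p) pt_eqE ?coords_neq0 //.
by rewrite /wedge subr_eq0 [y * _]mulrC.
Qed.

Lemma pt_eq_scale x y x' y' : (x != 0) || (y != 0) -> (x' != 0) || (y' != 0) ->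
  pt x y = pt x' y' -> exists2 k, k != 0 & x = k * x' /\ y = k * y'.
Proof.
move=> v0 w0 /eqP; rewrite pt_eqE // => /eqP e.
have [x0'|x0'] := eqVneq x' 0; last first.
  have x0 : x != 0.
    apply: contraL v0 => /eqP x0; rewrite x0 eqxx /=.
    by move/eqP: e; rewrite x0 mul0r eq_sym mulf_eq0 (negPf x0') /= => ->.
  exists (x / x'); first by rewrite mulf_neq0 ?invr_eq0.
  by rewrite divfK // mulrAC e mulrAC divff // mul1r.
rewrite x0' eqxx /= in w0; move/eqP: e;
  rewrite x0' mul0r mulf_eq0 (negPf w0) orbF => /eqP x0.
rewrite x0 eqxx /= in v0; exists (y / y'); first by rewrite mulf_neq0 ?invr_eq0.
by rewrite x0 mulr0 divfK.
Qed.

(** The determinant gets multiplied by ad - bc; a second factor compares the chosen coordinates of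
    the image with the image of those of p. *)
Lemma wedge_act a b c d p : a * d - b * c != 0 ->
  exists k, forall x y,
    wedge (a * x + b * y) (c * x + d * y) (act (mob a b c d) p) = k * wedge x y p.
Proof.
move=> D; have w0 : (a * xcoord p + b * ycoord p != 0)
    || (c * xcoord p + d * ycoord p != 0).
  rewrite -negb_and -vec2_eq0 -mul_mx2_vec2.
  have := coords_neq0 p; rewrite -negb_and -vec2_eq0; apply: contra => /eqP Av0.
  by rewrite -[vec2 _ _](@mulKmx _ _ _ (mx2 a b c d)) ?unitmx2 // Av0 mulmx0.
have := pt_coords (act (mob a b c d) p).
rewrite -{3}(pt_coords p) act_mob ?coords_neq0 //.
move/(pt_eq_scale (coords_neq0 _) w0) => [k _ [ex ey]].
by exists (k * (a * d - b * c)) => x y; rewrite /wedge ex ey; ring.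
Qed.

Lemma prod_wedge_act a b c d (Z : seq (P1 K)) : a * d - b * c != 0 -> uniq Z ->
  {in Z, forall p, act (mob a b c d) p \in Z} ->
  exists k, forall x y,
    \prod_(p <- Z) wedge (a * x + b * y) (c * x + d * y) p =
    k * \prod_(p <- Z) wedge x y p.
Proof.
move=> D uZ gZ; have e := mem_uniq_perm_eq (@act_inj _ _) uZ gZ.
suff [k ek] : exists k, forall x y,
    \prod_(p <- Z) wedge (a * x + b * y) (c * x + d * y) (act (mob a b c d) p) =
    k * \prod_(p <- Z) wedge x y p.
  by exists k => x y; rewrite -(perm_big _ e) big_map ek.
elim: (Z) => [|p s [k ek]]; first by exists 1 => x y; rewrite !big_nil mulr1.
have [k' ek'] := wedge_act p D; exists (k' * k) => x y.
by rewrite !big_cons ek ek' mulrACA.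
Qed.

(** The factor y accounts for the zero at infinity; C absorbs the choices of coordinates. *)
Lemma wedge_aff (S : seq K) :
  exists2 C, C != 0 & forall x y, y * \prod_(z <- S) (x - z * y) =
    C * \prod_(p <- inf :: [seq pt z 1 | z <- S]) wedge x y p.
Proof.
have [k k0 [ex ey]] := pt_eq_scale (coords_neq0 _) (nz10 K) (pt_coords (inf : P1 K)).
suff [C C0 eC] : exists2 C, C != 0 & forall x y, \prod_(z <- S) (x - z * y) =
    C * \prod_(p <- [seq pt z 1 | z <- S]) wedge x y p.
  (* The chosen coordinates of infinity are (k, 0), so its linear form is - k y. *)
  exists (- C / k); first by rewrite mulf_neq0 ?oppr_eq0 ?invr_eq0.
  move=> x y; rewrite eC big_cons /wedge ex ey mulr0 mulr1.
  by set P := \prod_(_ <- _) _; field.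
elim: S => [|z S [C C0 eC]]; first by exists 1; rewrite ?oner_neq0 // => x y;
  rewrite !big_nil mulr1.
have [l l0 [fx fy]] := pt_eq_scale (coords_neq0 _) (nz01 z) (pt_coords (pt z 1)).
exists (C / l); first by rewrite mulf_neq0 ?invr_eq0.
move=> x y; rewrite /= !big_cons eC /wedge fx fy mulr1.
by set P := \prod_(_ <- _) _; field.
Qed.

End Wedge.

Section Polar.
Variables (F : {mpoly algC[2]}) (d : nat) (Z : seq (P1 algC)) (C : algC).
Hypotheses (F_homog : F \is d.+1.-homog) (C0 : C != 0) (uniq_Z : uniq Z).
Hypothesis FE : forall x y, F.@[coord x y] = C * \prod_(p <- Z) wedge x y p.

(* In the affine chart this is z |-> z - deg(F) F / F'; by Euler's identity its
   fixed points are the zeros of F. *)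
Definition polar_form (i : 'I_2) := if i == 0 then F^`M(1) else - F^`M(0).

(** On the line through (x, y) in its own direction, F becomes F(x, y) (1 + t)^(d+1); compare
    derivatives at t = 0. *)
Lemma euler x y :
  x * F^`M(0).@[coord x y] + y * F^`M(1).@[coord x y] = d.+1%:R * F.@[coord x y].
Proof.
have e : line_poly (coord x y) (coord x y) F = F.@[coord x y] *: (1 + 'X) ^+ d.+1.
  apply: poly_ext => t; rewrite line_poly_eval hornerZ horner_exp !hornerE.
  rewrite mulrC -(meval_dhomogZ _ _ F_homog); apply: meval_eq => i.
  by rewrite mulrDl mul1r.
have := congr1 (fun p : {poly algC} => p^`().[0]) e.
rewrite /= line_poly_deriv2 derivZ deriv_exp derivD derivC derivX add0r.
rewrite hornerZ hornerMn !hornerE expr1n -mulr_natl mulr1.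
by rewrite [x * _]mulrC [y * _]mulrC => ->; rewrite mulrC.
Qed.

Lemma F_eq0 x y : (x != 0) || (y != 0) -> (F.@[coord x y] == 0) = (pt x y \in Z).
Proof.
move=> v0; rewrite FE mulf_eq0 (negPf C0) /=.
elim: (Z) => [|p s IHs]; first by rewrite big_nil oner_eq0.
by rewrite big_cons mulf_eq0 wedge_eq0 // inE IHs.
Qed.

(** By Euler's identity, a common zero of the partial derivatives is a zero p of F. As p is simple,
    F has nonzero derivative there in every direction transverse to p, a contradiction. *)
Lemma polar_neq0 (v : 'cV[algC]_2) : v != 0 -> form_eval polar_form v != 0.
Proof.
rewrite [v]vec2_eta; move: (v 0 0) (v 1 0) => x y.
rewrite vec2_eq0 negb_and form_eval_vec2 vec2_eq0 => v0.
apply/negP => /andP[/eqP]; rewrite /= /polar_form /= => Fy0.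
rewrite mevalN oppr_eq0 => /eqP Fx0.
have /eqP := euler x y; rewrite Fx0 Fy0 !mulr0 addr0 eq_sym mulf_eq0 pnatr_eq0 /=.
rewrite F_eq0 // => xyZ; set p := pt x y in xyZ.
(* One of the two coordinate directions is transverse to p. *)
have [s [t [w0 st]]] : exists s t, ((s != 0) || (t != 0)) /\ wedge s t p != 0.
  have [x0|x0] := eqVneq x 0.
    exists 1, 0; rewrite nz10 wedge_eq0 ?nz10 // pt_eqE ?nz10 // x0 mul0r mul1r.
    by rewrite x0 eqxx /= in v0.
  exists 0, 1; rewrite orbC oner_neq0 wedge_eq0 ?nz01 // pt_eqE ?nz01 // mulr1 mul0r eq_sym.
  by [].
(* On this line the factor of p is a multiple of the parameter, and the other factors do not vanish
   at 0. *)
have e : line_poly (coord x y) (coord s t) F = wedge s t p *: ('X *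
    (C *: \prod_(q <- rem p Z) ((wedge x y q)%:P + wedge s t q *: 'X))).
  apply: poly_ext => u; rewrite line_poly_eval2 FE (big_rem _ xyZ) /=.
  rewrite hornerZ hornerM hornerX hornerZ horner_prod.
  have -> : wedge (x + u * s) (y + u * t) p = u * wedge s t p.
    have /eqP : wedge x y p == 0 by rewrite wedge_eq0.
    by rewrite /wedge => xyp; rewrite -[RHS]addr0 -xyp; ring.
  rewrite [RHS]mulrA [X in _ = X * _]mulrC [LHS]mulrCA; congr (_ * (_ * _)).
  by apply: eq_bigr => q _; rewrite /wedge !hornerE; ring.
have := congr1 (fun r : {poly algC} => r^`().[0]) e.
rewrite /= line_poly_deriv2 Fx0 Fy0 !mul0r addr0 derivZ derivM derivX mul1r.
rewrite hornerZ hornerD hornerM hornerX mul0r addr0 hornerZ horner_prod.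
apply/eqP; rewrite eq_sym !mulf_neq0 // prodf_seq_neq0; apply/allP => q.
rewrite rem_filter // mem_filter => /andP[/= qp _].
by rewrite !hornerE wedge_eq0 // eq_sym.
Qed.

Lemma polar_homog i : polar_form i \is d.-homog.
Proof.
by rewrite /polar_form; case: ifP => _; rewrite ?rpredN dhomog_mderiv.
Qed.

Definition polar := EndoP1 polar_homog polar_neq0.

Lemma polar_pt x y : (x != 0) || (y != 0) ->
  endo_fun polar (pt x y) = pt F^`M(1).@[coord x y] (- F^`M(0).@[coord x y]).
Proof. by move=> v0; rewrite endo_fun_pt // /= /polar_form /= mevalN. Qed.

Lemma polar_pt_neq0 x y : (x != 0) || (y != 0) ->
  (F^`M(1).@[coord x y] != 0) || (- F^`M(0).@[coord x y] != 0).
Proof.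
rewrite -negb_and -vec2_eq0 => /polar_neq0.
by rewrite form_eval_vec2 vec2_eq0 negb_and /polar_form /= mevalN.
Qed.

(** Cross-multiplying the coordinates of the image and of the point produces the left side of
    Euler's identity. *)
Lemma fixed_polar p : fixed polar p <-> p \in Z.
Proof.
elim/pt_ind: p => x y v0; rewrite /fixed polar_pt // -F_eq0 //.
set u := pt _ _; set v := pt x y;
  rewrite (rwP (u =P v)) pt_eqE ?polar_pt_neq0 // -subr_eq0 mulrN opprK addrC mulrC.
rewrite [X in _ + X]mulrC [X in X + _]mulrC euler mulf_eq0 pnatr_eq0 //.
Qed.

Lemma Aut_polar g : Aut polar g <-> {in Z, forall p, act g p \in Z}.
Proof.
split=> [fg p /fixed_polar fp|]; first exact/fixed_polar/fixed_Aut.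
elim/mob_ind: g => a b c e D gZ.
have [k ek] := prod_wedge_act D uniq_Z gZ.
have inv x y : F.@[coord (a * x + b * y) (c * x + e * y)] = k * F.@[coord x y].
  by rewrite !FE ek mulrCA.
apply/AutP; elim/pt_ind => x y v0.
have w0 : (a * x + b * y != 0) || (c * x + e * y != 0).
  move: v0; rewrite -!negb_and -!vec2_eq0 -mul_mx2_vec2; apply: contra => /eqP Av0.
  by rewrite -[vec2 _ _](@mulKmx _ _ _ (mx2 a b c e)) ?unitmx2 // Av0 mulmx0.
rewrite act_mob // !polar_pt // act_mob ?polar_pt_neq0 //.
have [e0 e1] := mderiv_invariant inv x y.
(* Otherwise the gradient of F would vanish at the image point, as the transposed matrix is
   invertible. *)
have k0 : k != 0.
  apply/eqP => k0; move: e0 e1; rewrite k0 !mul0r => e0 e1.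
  have := polar_pt_neq0 w0; set G0 := F^`M(0).@[_] in e0 e1 *;
    set G1 := F^`M(1).@[_] in e0 e1 *.
  have d0 : (a * e - b * c) * G0 = 0.
    by transitivity (e * (a * G0 + c * G1) - c * (b * G0 + e * G1));
      [ring|rewrite e0 e1 !mulr0 subrr].
  have d1 : (a * e - b * c) * G1 = 0.
    by transitivity (a * (b * G0 + e * G1) - b * (a * G0 + c * G1));
      [ring|rewrite e0 e1 !mulr0 subrr].
  move/eqP: d0; move/eqP: d1; rewrite !mulf_eq0 (negPf D) /= => /eqP-> /eqP->.
  by rewrite oppr0 eqxx.
(* The gradient transforms by the inverse transpose; turned by a right angle it transforms by the
   matrix itself, up to k and the determinant. *)
rewrite -[RHS](ptZ _ _ k0) -[LHS](ptZ _ _ D).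
by congr (pt _ _); rewrite !mulrDr ![k * (_ * _)]mulrCA !mulrN -?e0 -?e1; ring.
Qed.

End Polar.

(** * Realization by power maps and by stabilizers *)

Notation ratC := (ratr : {rmorphism rat -> algC}).

Definition realizable (Gamma : set (PGL2 algC)) :=
  exists f : endoP1 algC,
    [/\ (2 <= degree f)%N, defined_over ratC f & Aut f = Gamma].

Lemma map_mderiv (k K : fieldType) (iota : {rmorphism k -> K}) n (F : {mpoly k[n]}) i :
  (map_mpoly iota F)^`M(i) = map_mpoly iota F^`M(i).
Proof.
by apply/mpolyP => m; rewrite mcoeff_mderiv !mcoeff_map_mpoly /= mcoeff_mderiv raddfMn.
Qed.

Lemma dhomog_XX (R : nzRingType) a b :
  ('X_0 ^+ a * 'X_1 ^+ b : {mpoly R[2]}) \is (a + b).-homog.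
Proof.
have X1 i k : ('X_i ^+ k : {mpoly R[2]}) \is k.-homog.
  by rewrite -{2}(mul1n k) dhomogMn // dhomogX /= mdeg1.
exact: dhomogM.
Qed.

Section Homogenize.
Variable R : comNzRingType.
(** The sum stops before i = n, so every monomial contains the second variable: for p of degree n -
    1 the form has a simple zero at infinity. *)
Definition homogenize n (p : {poly R}) : {mpoly R[2]} :=
  \sum_(i < n) p`_i *: ('X_0 ^+ i * 'X_1 ^+ (n - i)).

Lemma homogenize_homog n p : homogenize n p \is n.-homog.
Proof.
rewrite rpred_sum // => i _; apply: rpredZ.
by have := dhomog_XX R i (n - i); rewrite subnKC // ltnW.
Qed.
End Homogenize.

Lemma map_homogenize (k K : fieldType) (iota : {rmorphism k -> K}) n p :
  map_mpoly iota (homogenize n p) = homogenize n (map_poly iota p).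
Proof.
rewrite /homogenize rmorph_sum; apply: eq_bigr => i _.
by rewrite /= map_mpolyZ rmorphM !rmorphXn /= !map_mpolyX coef_map.
Qed.

Lemma homogenize_eval (K : closedFieldType) n (p : {poly K}) x y : (size p <= n)%N ->
  (homogenize n p).@[coord x y] = if y == 0 then 0 else y ^+ n * p.[x / y].
Proof.
move=> pn; rewrite /homogenize raddf_sum /=.
have E (i : 'I_n) : (p`_i *: ('X_0 ^+ i * 'X_1 ^+ (n - i)) : {mpoly K[2]}).@[coord x y]
    = p`_i * (x ^+ i * y ^+ (n - i)).
  by rewrite mevalZ mevalM !rmorphXn /= !mevalXU.
under eq_bigr do rewrite E.
have [->|y0] := eqVneq y 0.
  by rewrite big1 // => i _; rewrite expr0n subn_eq0 leqNgt ltn_ord !mulr0.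
rewrite (horner_coef_wide _ pn) mulr_sumr; apply: eq_bigr => i _.
rewrite exprB ?unitfE //; last exact: ltnW.
by rewrite expr_div_n; move: (x ^+ i) (y ^+ n) (y ^- i) => u v w; ring.
Qed.

Definition stab (K : fieldType) (Z : seq (P1 K)) : set (PGL2 K) :=
  [set g | {in Z, forall p, act g p \in Z}]%classic.

Lemma realizable_stab (p : {poly rat}) (S : seq algC) :
    (1 < size S)%N -> uniq S -> map_poly ratC p = \prod_(z <- S) ('X - z%:P) ->
  realizable (stab (inf :: [seq pt z 1 | z <- S])).
Proof.
move=> S2 uS pS; set Z := inf :: _; set m := size S.
have uZ : uniq Z.
  rewrite /= map_inj_uniq ?uS ?andbT; last exact: pt_inj.
  by apply/mapP => -[z _ e]; apply: (@pt_neq_inf _ z).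
have [C C0 eC] := wedge_aff S.
(* Since p has degree m, this form vanishes at infinity and on S; the resulting map has degree m >=
   2. *)
pose F0 := homogenize m.+1 p; pose F := map_mpoly ratC F0.
have FE x y : F.@[coord x y] = C * \prod_(q <- Z) wedge x y q.
  rewrite -eC /F map_homogenize pS homogenize_eval ?size_prod_XsubC //.
  have [->|y0] := eqVneq y 0; first by rewrite mul0r.
  rewrite exprS -mulrA; congr (_ * _); rewrite horner_prod /m.
  elim: (S) => [|z s IHs]; first by rewrite !big_nil mulr1.
  rewrite !big_cons /= exprS mulrACA IHs; congr (_ * _).
  by rewrite hornerXsubC mulrBr mulrC divfK // [y * z]mulrC.
have Fh : F \is m.+1.-homog by rewrite /F map_homogenize homogenize_homog.
exists (polar Fh C0 uZ FE); split=> //=.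
  exists (fun i : 'I_2 => if i == 0 then F0^`M(1) else - F0^`M(0)), 1.
  split=> [|i]; first exact: oner_neq0.
  rewrite scale1r /= /polar_form; case: ifP => _; first exact: map_mderiv.
  by rewrite rmorphN /= map_mderiv.
by apply/seteqP; split => g; apply Aut_polar.
Qed.

(* z |-> z ^ (n + 1) + e z, for e = 0 or 1. *)
Definition pow_form (R : nzRingType) (e : bool) n (i : 'I_2) : {mpoly R[2]} :=
  if i == 0 then 'X_0 ^+ n.+1 + ('X_0 * 'X_1 ^+ n) *+ e else 'X_1 ^+ n.+1.

Lemma pow_form_homog (R : nzRingType) e n i : pow_form R e n i \is n.+1.-homog.
Proof.
rewrite /pow_form; case: ifP => _.
  rewrite rpredD ?rpredMn //; last exact: (dhomog_XX R 1 n).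
  by have := dhomog_XX R n.+1 0; rewrite addn0 mulr1.
by have := dhomog_XX R 0 n.+1; rewrite add0n mul1r.
Qed.

Lemma pow_form_eval (K : closedFieldType) e n x y :
  ((pow_form K e n 0).@[coord x y] = x ^+ n.+1 + (x * y ^+ n) *+ e) *
  ((pow_form K e n 1).@[coord x y] = y ^+ n.+1).
Proof.
by rewrite /pow_form /= mevalD mevalMn mevalM !rmorphXn /= !mevalXU.
Qed.

Lemma pow_neq0 (K : closedFieldType) e n (v : 'cV[K]_2) : (0 < n)%N ->
  v != 0 -> form_eval (pow_form K e n) v != 0.
Proof.
move=> n0; rewrite [v]vec2_eta form_eval_vec2 !vec2_eq0 !pow_form_eval.
apply: contra => /andP[/eqP ex]; rewrite expf_eq0 /= => /eqP ey.
move/eqP: ex; rewrite ey eqxx andbT expr0n eqn0Ngt n0 mulr0 mul0rn addr0.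
by rewrite expf_eq0.
Qed.

Definition homotheties (n : nat) : set (PGL2 algC) :=
  [set g | exists2 a : algC, a ^+ n = 1 & g = aff a 0]%classic.

(* Of order 2 n. *)
Definition dihedral (n : nat) : set (PGL2 algC) :=
  [set g | exists2 a : algC, a ^+ n = 1 & g = aff a 0 \/ g = (aff a 0 * swap
    algC)%g]%classic.

Lemma unity_root_neq0 (K : fieldType) n (a : K) : (0 < n)%N -> a ^+ n = 1 -> a != 0.
Proof.
by move=> n0 an; apply/eqP => a0; move/eqP: an;
  rewrite a0 expr0n eqn0Ngt n0 eq_sym oner_eq0.
Qed.

Section PowerMaps.
Variables (n : nat) (n0 : (0 < n)%N).

Definition pow_map e : endoP1 algC :=
  EndoP1 (pow_form_homog algC e n) (fun v => @pow_neq0 algC e n v n0).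

Lemma pow_map_rational e : defined_over ratC (pow_map e).
Proof.
exists (pow_form rat e n), 1; split=> [|i]; first exact: oner_neq0.
rewrite scale1r /= /pow_form; case: ifP => _; last by rewrite rmorphXn /= map_mpolyX.
by rewrite rmorphD rmorphMn rmorphM !rmorphXn /= !map_mpolyX.
Qed.

Lemma pow_map_pt e x y : (x != 0) || (y != 0) ->
  endo_fun (pow_map e) (pt x y) = pt (x ^+ n.+1 + (x * y ^+ n) *+ e) (y ^+ n.+1).
Proof. by move=> v0; rewrite endo_fun_pt // /= !pow_form_eval. Qed.

Lemma pow_map_aff e x : endo_fun (pow_map e) (pt x 1) = pt (x ^+ n.+1 + x *+ e) 1.
Proof. by rewrite pow_map_pt ?nz01 // !expr1n mulr1. Qed.

Lemma pow_map_inf e : endo_fun (pow_map e) inf = inf.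
Proof.
by rewrite pow_map_pt ?nz10 // !expr0n expr1n eqn0Ngt n0 mulr0 mul0rn addr0.
Qed.

Lemma exceptional_inf e : exceptional (pow_map e) inf.
Proof. by move=> q; case: (pointP q) => // x; rewrite pow_map_aff => /pt_neq_inf. Qed.

Lemma pow_map_hom e a : a ^+ n = 1 -> Aut (pow_map e) (aff a 0).
Proof.
move=> an; have a0 := unity_root_neq0 n0 an; apply/AutP => p.
case: (pointP p) => [|x]; first by rewrite pow_map_inf !act_aff_inf // pow_map_inf.
rewrite act_aff // !pow_map_aff act_aff // !addr0 exprMn exprS an mulr1.
by rewrite mulrDr mulrnAr.
Qed.

Lemma exceptional_pow1 x : ~ exceptional (pow_map true) (pt x 1).
Proof.
have [->|x0] := eqVneq x 0 => ex.
  (* A solution of w^n = -1 is a second preimage of 0. *)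
  pose w : algC := n.-root (-1).
  have wn : w ^+ n = -1 by rewrite rootCK.
  suff /pt_inj w0 : pt w 1 = pt 0 1.
    by move/eqP: wn; rewrite w0 expr0n eqn0Ngt n0 eq_sym oppr_eq0 oner_eq0.
  by apply: ex; rewrite pow_map_aff exprS wn mulrN1 addNr.
(* A preimage of x exists; being equal to x, it gives x^(n+1) = 0. *)
have sz : size ('X^(n.+1) + ('X - x%:P)) != 1%N.
  by rewrite size_polyDl size_polyXn // size_XsubC ltnS.
have [w] := closed_rootP _ sz;
  rewrite rootE hornerD hornerXn hornerXsubC addrA subr_eq0 => /eqP ew.
have /pt_inj wx : pt w 1 = pt x 1 by apply: ex; rewrite pow_map_aff ew.
move/eqP: ew; rewrite wx -subr_eq0 addrK expf_eq0 /= (negPf x0) //.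
Qed.

Lemma exceptional_pow0 x : exceptional (pow_map false) (pt x 1) -> x = 0.
Proof.
move=> ex; apply/eqP/negPn/negP => x0.
(* A primitive (n+1)-th root of unity turns one preimage of x into another. *)
have [z pz] := C_prim_root_exists (ltn0Sn n).
pose w : algC := n.+1.-root x.
have wn : w ^+ n.+1 = x by rewrite rootCK.
have w0 : w != 0 by apply: contra x0 => /eqP w0; rewrite -wn w0 expr0n.
have /pt_inj wx : pt w 1 = pt x 1 by apply: ex; rewrite pow_map_aff wn addr0.
have /pt_inj zx : pt (z * w) 1 = pt x 1.
  by apply: ex; rewrite pow_map_aff addr0 exprMn (prim_expr_order pz) mul1r wn.
have z1 : z = 1 by apply: (mulIf w0); rewrite mul1r zx wx.
by move: (prim_order_dvd pz 1); rewrite expr1 z1 eqxx dvdn1 eqSS eqn0Ngt n0.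
Qed.

Lemma Aut_pow_hom e a : a != 0 -> Aut (pow_map e) (aff a 0) -> a ^+ n = 1.
Proof.
move=> a0 /AutP/(_ (pt 1 1)); rewrite pow_map_aff !act_aff // pow_map_aff => /pt_inj.
rewrite mulr1 !addr0 expr1n mulrDr mulr1 mulrnAr mulr1 => /addIr.
by rewrite exprS -[RHS]mulr1 => /(mulfI a0).
Qed.

Lemma Aut_pow1 : Aut (pow_map true) = homotheties n.
Proof.
apply/seteqP; split=> g; last by case=> a an ->; apply: pow_map_hom.
move=> fg; have gi : act g inf = inf.
  have := exceptional_Aut fg (@exceptional_inf true).
  by case: (pointP (act g inf)) => // x /exceptional_pow1.
have [a [b [a0 eg]]] := fix_infP gi; rewrite eg in fg *.
suff b0 : b = 0 by rewrite b0 in fg *; exists a => //; apply: Aut_pow_hom fg.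
(* Commutation is tested at the preimage -b/a of 0 under g: since f fixes 0, it gives a (-b/a)^(n+1)
   = 0. *)
have /AutP/(_ (pt (- (b / a)) 1)) := fg.
have e0 : a * - (b / a) + b = 0 by rewrite mulrN mulrCA divff // mulr1 addNr.
rewrite pow_map_aff !act_aff // pow_map_aff => /pt_inj;
  rewrite e0 expr0n addr0 mulrDr -addrA e0.
rewrite addr0 => /eqP; rewrite eq_sym mulf_eq0 (negPf a0) expf_eq0 /= oppr_eq0.
by rewrite mulf_eq0 invr_eq0 (negPf a0) orbF => /eqP.
Qed.

Lemma Aut_pow0_swap : Aut (pow_map false) (swap algC).
Proof.
apply/AutP; elim/pt_ind => x y v0; rewrite act_swap // !pow_map_pt ?(orbC (y != 0)) //.
by rewrite !addr0 act_swap // -negb_and !expf_eq0 /= negb_and.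
Qed.

Lemma Aut_pow0 : Aut (pow_map false) = dihedral n.
Proof.
apply/seteqP; split=> g; last first.
  case=> a an [->|->]; first exact: pow_map_hom.
  by apply: AutM; [apply: pow_map_hom | apply: Aut_pow0_swap].
(* The only exceptional points are infinity and 0, so an automorphism fixing one fixes the other. *)
have fixing h : Aut (pow_map false) h -> act h inf = inf -> homotheties n h.
  move=> fh hi; suff h0 : act h (pt 0 1) = pt 0 1.
    by have [a a0 eh] := fix_inf_0P hi h0; exists a => //;
      apply: (@Aut_pow_hom false) => //; rewrite -eh.
  have : exceptional (pow_map false) (act h (pt 0 1)).
    apply: exceptional_Aut => // q; case: (pointP q) => [|x].
      by rewrite pow_map_inf => /esym/pt_neq_inf.
    by rewrite pow_map_aff addr0 => /pt_inj/eqP; rewrite expf_eq0 /= => /eqP->.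
  case: (point_cases (act h (pt 0 1))) => [e _|[x ->] /exceptional_pow0 -> //].
  by case: (@pt_neq_inf algC 0); apply: (@act_inj _ h); rewrite e hi.
move=> fg; have := exceptional_Aut fg (@exceptional_inf false).
case: (point_cases (act g inf)) => [gi _|[x gx]].
  by have [a an ->] := fixing g fg gi; exists a => //; left.
(* Here g sends infinity to 0, so [fixing] applies to [swap * g]. *)
rewrite gx => /exceptional_pow0 x0;
  have fgs : Aut (pow_map false) (swap algC * g)%g by apply: AutM => //;
    apply: Aut_pow0_swap.
have [|a an ega] := fixing _ fgs; first by rewrite actM gx x0 act_swap ?nz01.
exists a^-1; first by rewrite exprVn an invr1.
right; rewrite -swap_aff ?(unity_root_neq0 n0 an) // -ega.
by rewrite mulgA swapK mul1g.
Qed.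

End PowerMaps.

Lemma realizable_homotheties n : (0 < n)%N -> realizable (homotheties n).
Proof.
move=> n0; exists (pow_map n0 true); split; [by []|exact: pow_map_rational|exact: Aut_pow1].
Qed.

Lemma realizable_dihedral n : (0 < n)%N -> realizable (dihedral n).
Proof.
move=> n0; exists (pow_map n0 false); split;
  [by []|exact: pow_map_rational|exact: Aut_pow0].
Qed.

(** * Orbits with nontrivial stabilizers *)

Section FiniteSubgroupType.
Variables (G : groupType) (s : seq G).
(** Indexing the type by the proof of closure lets its group structure be inferred from the type
    alone. *)
Definition subgroup_of (cl : group_closed (fun x => x \in s)) := seq_sub s.
Variable cl : group_closed (fun x => x \in s).
HB.instance Definition _ := SubFinite.on (subgroup_of cl).
HB.instance Definition _ := SubChoice_isSubGroup.Build G _ (subgroup_of cl) cl.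
End FiniteSubgroupType.

(** Division by N gives 1/n1 + 1/n2 + 1/n3 = 1 + 2/N with n1 >= n2 >= n3, whence n3 = 2 and n2 <=
    3. *)
Lemma orbit_size_arith N n1 n2 n3 s1 s2 s3 :
  (1 < N -> 1 < n1 -> 1 < n2 -> 1 < n3 ->
  s1 * n1 = N -> s2 * n2 = N -> s3 * n3 = N -> s1 <= s2 -> s2 <= s3 ->
  s1 + (s2 + s3) = N + 2 ->
  s1 = 2 \/ (n1, s1) \in [:: (3, 4); (4, 6); (5, 12)])%N.
Proof.
move=> N1 h1 h2 h3 e1 e2 e3 l12 l23 e.
have n3E : n3 = 2%N.
  suff : ~~ (3 <= n3)%N by lia.
  by apply/negP => h; have := leq_mul (leqnn s3) h; lia.
have n2E : (n2 <= 3)%N.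
  rewrite leqNgt; apply/negP => h; have := leq_mul (leqnn s2) h.
  by subst n3; lia.
have [n2E2|n2E3] : n2 = 2%N \/ n2 = 3%N by lia.
  by left; subst n2 n3; lia.
(* Here s2 = N/3 and s3 = N/2, so that N = 6 s1 - 12. *)
right; subst n2 n3; have e' : (s1 * n1 = 6 * s1 - 12)%N by lia.
have n1E : (n1 < 6)%N.
  by rewrite ltnNge; apply/negP => h; have := leq_mul (leqnn s1) h; lia.
have : n1 = 2%N \/ n1 = 3%N \/ n1 = 4%N \/ n1 = 5%N by lia.
case=> [n1E2|[n1E3|[n1E4|n1E5]]]; subst n1; first lia.
- by rewrite (_ : s1 = 4%N) ?inE //; lia.
- by rewrite (_ : s1 = 6%N) ?inE //; lia.
- by rewrite (_ : s1 = 12%N) ?inE //; lia.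
Qed.

(* Burnside's count: with k orbits, #|T| + 2 (N - 1) = k N, and every orbit has
   size at most N / 2, so that k is 2 or 3; x is taken in a smallest orbit. *)
Lemma special_orbit (gT : finGroupType) (T : finType) (to : {action gT &-> T}) :
    (1 < #|gT|)%N ->
    (forall g : gT, g != 1%g -> #|'Fix_to[g]%g| = 2) ->
    (forall x, 'C[x | to]%g != 1%g) ->
  exists x, let n := #|'C[x | to]%g| in let s := #|orbit to [set: gT]%G x| in
    (1 < n)%N /\ [\/ s = 1, s = 2 | (n, s) \in [:: (3, 4); (4, 6); (5, 12)]]%N.
Proof.
move=> N1 fix2 stab1; set N := #|gT| in N1; pose G := [set: gT]%G.
have actG : [acts G, on [set: T]%SET | to]%g by apply/actsP => g _ x; rewrite !inE.
have count := acts_sum_card_orbit actG.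
have burnside := Frobenius_Cauchy actG.
rewrite !cardsT -/N in count burnside.
set orbs := (orbit to G @: [set: T]%SET)%g in count burnside.
(* The identity fixes all of T, each of the other N - 1 elements exactly two points. *)
have {burnside} burnside : (#|T| + (N.-1).*2 = #|orbs| * N)%N.
  rewrite -burnside (bigD1 1%g) ?inE //=; congr (_ + _)%N.
    rewrite -cardsT; apply: eq_card => x; rewrite !inE; symmetry.
    by rewrite finset.sub1set inE action.act1 eqxx.
  rewrite (eq_bigr (fun=> 2)) => [|g /andP[_ g1]]; last by rewrite finset.setTI fix2.
  rewrite sum_nat_const -muln2; congr (_ * _)%N.
  by rewrite /N [in LHS](cardD1 1%g) /=; apply: eq_card => g;
    rewrite !inE andbT -topredE /= finset.in_setT.
have orbP O : O \in orbs -> exists2 x, O = orbit to G x & (#|O| * #|'C[x | to]%g| = N)%N.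
  case/imsetP => x _ ->; exists x => //.
  by rewrite /N -[RHS]cardsT -(card_orbit_stab to G x) finset.setTI.
have stab_gt1 x : (1 < #|'C[x | to]%g|)%N by rewrite cardG_gt1 (stab1 x).
pose r := [rel A B : {set T} | #|A| <= #|B|]%N.
pose os := sort r (enum orbs).
have osE : os =i orbs by move=> O; rewrite mem_sort mem_enum.
have sz : size os = #|orbs| by rewrite size_sort -cardE.
have sorted_os : sorted r os by apply: sort_sorted => A B; apply: leq_total.
have {count} count : \sum_(O <- os) #|O| = #|T|.
  by rewrite -count -big_enum; apply: perm_big; rewrite perm_sort.
rewrite -sz -count in burnside.
case: os osE sorted_os burnside {sz count} => [|A [|B [|C [|D os]]]] osE sorted_os.
- by rewrite big_nil /=; lia.
- have /orbP [x eA cA] : A \in orbs by rewrite -osE mem_head.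
  have := stab_gt1 x; rewrite big_cons big_nil /=; nia.
- have /orbP [x eA cA] : A \in orbs by rewrite -osE mem_head.
  have /orbP [y eB cB] : B \in orbs by rewrite -osE !inE eqxx orbT.
  (* With two orbits, T has two points, so each orbit is a single point. *)
  rewrite !big_cons big_nil /= => e; exists x; split=> //; constructor 1; rewrite -eA.
  nia.
- have /orbP [x eA cA] : A \in orbs by rewrite -osE mem_head.
  have /orbP [y eB cB] : B \in orbs by rewrite -osE !inE eqxx orbT.
  have /orbP [z eC cC] : C \in orbs by rewrite -osE !inE eqxx !orbT.
  rewrite !big_cons big_nil /= => e; exists x; split=> //; rewrite -eA.
  have /and3P[lAB lBC _] := sorted_os.
  have e' : (#|A| + (#|B| + #|C|) = N + 2)%N by lia.
  by case: (orbit_size_arith N1 (stab_gt1 x) (stab_gt1 y) (stab_gt1 z) cA cB cC lAB lBC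
    e') => ?;
    [constructor 2|constructor 3].
(* Four or more orbits are impossible: k orbits of size at most N/2 give at most kN/2 points, less
   than the required (k - 2) N + 2. *)
have half O : O \in [:: A, B, C, D & os] -> (#|O| * 2 <= N)%N.
  rewrite osE => /orbP[x _ <-]; exact: leq_mul.
suff bound : (2 * (\sum_(O <- [:: A, B, C, D & os]) #|O|) <= N * size [:: A, B, C, D &
  os])%N.
  move=> e; exfalso; have : (4 * N <= size [:: A, B, C, D & os] * N)%N.
    by rewrite leq_mul2r /= orbT.
  by move: bound e; set S := (\sum_(_ <- _) _)%N; set l := size _; nia.
elim: [:: A, B, C, D & os] half => [|O l IHl] half; first by rewrite big_nil.
have hO := half O (mem_head _ _).
have hl : (2 * (\sum_(O <- l) #|O|) <= N * size l)%N.
  by apply: IHl => P Pl; apply: half; rewrite inE Pl orbT.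
by rewrite big_cons /= mulnS mulnDr; lia.
Qed.

Lemma aff_transX (K : fieldType) (b : K) k : (aff 1 b ^+ k = aff 1 (b *+ k))%g.
Proof.
elim: k => [|k IHk]; first by rewrite expg0 aff1.
by rewrite expgS IHk aff_mul ?oner_neq0 // !mul1r mulrS addrC.
Qed.

Lemma aff_translation (b : algC) k : (0 < k)%N -> (aff 1 b ^+ k = 1)%g -> b = 0.
Proof.
move=> k0; rewrite aff_transX -aff1 => /(aff_inj (oner_neq0 _) (oner_neq0 _))[_ /eqP].
by rewrite mulrn_eq0 eqn0Ngt k0 => /eqP.
Qed.

Lemma exists_fixpoint (K : closedFieldType) (g : PGL2 K) : exists p, act g p = p.
Proof.
elim/mob_ind: g => a b c d D.
have [c0|c0] := eqVneq c 0.
  exists inf; rewrite act_mob ?nz10 // c0 !mulr0 !addr0 mul0r mulr1 pt_inf //.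
  by apply: contraNneq D => a0; rewrite a0 c0 mul0r mulr0 subrr.
(* The fixed point equation z (c z + d) = a z + b in monic form. *)
have [z ez] := solve_monicpoly (fun i => if i == 0%N then b / c else (a - d) / c) (isT
  : (0 < 2)%N).
rewrite big_ord_recl big_ord1 /= expr0 expr1 mulr1 in ez.
have zE : a * z + b = z * (c * z + d).
  have -> : z * (c * z + d) = c * z ^+ 2 + d * z by ring.
  by rewrite ez; field.
exists (pt z 1); rewrite act_mob ?nz01 // !mulr1 zE -[RHS](ptZ _ _ (_ : c * z + d != 0)).
  by rewrite mulr1 mulrC.
(* If c z + d = 0, then a z + b = 0 too, and the matrix is singular. *)
apply: contra D => /eqP e; move: zE; rewrite e mulr0 => e'.
have -> : a * d - b * c = a * (c * z + d) - c * (a * z + b) by ring.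
by rewrite e e' !mulr0 subrr.
Qed.

Lemma act_conj (K : fieldType) (g h : PGL2 K) p :
  act (conjg g h) (act h^-1%g p) = act h^-1%g (act g p).
Proof. by rewrite -!actM /conjg !mulgA mulgK. Qed.

(** With one fixed point moved to infinity, g becomes z |-> a z + b. Here a <> 1, since a nontrivial
    translation has infinite order, so b / (1 - a) is the only other fixed point. *)
Lemma fixpoints_finite_order (g : PGL2 algC) k : (0 < k)%N -> (g ^+ k = 1)%g -> g != 1%g ->
  exists pq : P1 algC * P1 algC,
    pq.1 != pq.2 /\ forall x, act g x = x <-> x = pq.1 \/ x = pq.2.
Proof.
move=> k0 gk g1; have [p gp] := exists_fixpoint g.
have [q qp] : exists q : P1 algC, p <> q.
  by case: (pointP p) => [|x];
    [exists (pt 0 1) => /esym/pt_neq_inf | exists inf => /pt_neq_inf].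
have [h hp _] := trans2 qp.
have g'inf : act (conjg g h) inf = inf.
  by rewrite -[X in act _ X](actK h) act_conj hp gp -hp actK.
have [a [b [a0 e]]] := fix_infP g'inf.
have a1 : a != 1.
  apply: contra g1 => /eqP a1; have : ((conjg g h) ^+ k = 1)%g by rewrite -conjXg gk conj1g.
  rewrite e a1 => /(aff_translation k0) b0; apply/eqP/(@conjg_inj _ h).
  by rewrite conj1g e a1 b0 aff1.
have a1' : 1 - a != 0 by rewrite subr_eq0 eq_sym.
pose z := b / (1 - a); exists (p, act h (pt z 1)); split.
  apply/eqP => /= ep; apply: (@pt_neq_inf algC z); apply: (@act_inj _ h).
  by rewrite -ep.
have fixE x : act g x = x <-> act (conjg g h) (act h^-1%g x) = act h^-1%g x.
  by rewrite act_conj; split=> [->//|/act_inj].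
move=> x; rewrite -[x](actKV h); set y := act h^-1%g x; rewrite fixE e actK /= -hp.
case: (point_cases y) => [->|[{}y ->]].
  by rewrite act_aff_inf //; split=> // _; left.
rewrite act_aff //; split=> [/pt_inj ey|[/act_inj/pt_neq_inf|/act_inj/pt_inj->]] //.
  right; congr (act _ (pt _ _)); rewrite /z -[LHS](mulfK a1'); congr (_ / _).
  by rewrite mulrBr mulr1 -{1}ey mulrC; ring.
by congr (pt _ _); rewrite /z; field.
Qed.

(* The stabilizer of p in Gamma has order n and its orbit has k points. *)
Definition orbit_data (Gamma : set (PGL2 algC)) (p : P1 algC) (n k : nat) :=
  (exists s : seq (PGL2 algC), [/\ uniq s, size s = n,
     forall g, g \in s <-> Gamma g /\ act g p = p & forall g, g \in s -> (g ^+ n = 1)%g]) /\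
  (exists O : seq (P1 algC), [/\ uniq O, size O = k &
     forall q, q \in O <-> exists2 g, Gamma g & act g p = q]).

Lemma finite_subgroup_seq (G : groupType) (A : set G) : finite_subgroup A ->
  exists s : seq G, [/\ uniq s, forall g, g \in s <-> A g & group_closed (fun x => x
    \in s)].
Proof.
case=> /finite_seqP [s0 eA] cl; exists (undup s0).
have sA g : g \in undup s0 <-> A g by rewrite mem_undup eA.
have sE g : (g \in (fun x => x \in undup s0)) = (g \in mem A).
  by rewrite -topredE /=; apply/idP/idP; [move/sA => ?; apply/mem_set|move/set_mem => ?;
    apply/sA].
split=> //; first exact: undup_uniq.
by case: cl => A1 AB; split=> [|x y]; rewrite !sE //; apply: AB.
Qed.

Lemma orbit_data_exists (Gamma : set (PGL2 algC)) :
    finite_subgroup Gamma -> (exists2 g, Gamma g & g != 1%g) ->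
  exists p n k, [/\ (1 < n)%N, orbit_data Gamma p n k &
    [\/ k = 1, k = 2 | (n, k) \in [:: (3, 4); (4, 6); (5, 12)]]%N].
Proof.
move=> /finite_subgroup_seq[s [us sG cl]] [g1 Gg1 g1n].
pose gT : finGroupType := subgroup_of cl.
pose v (g : gT) : PGL2 algC := val (g : subgroup_of cl).
have vM g h : v (g * h)%g = (v g * v h)%g by [].
have vV g : v g^-1%g = (v g)^-1%g by [].
have v1 : v 1%g = 1%g by [].
have vX g k : v (g ^+ k)%g = (v g ^+ k)%g.
  by elim: k => [|k IHk]; rewrite ?expg0 // !expgS vM IHk.
have vI : injective v by apply: val_inj.
have vG g : Gamma (v g) by apply/sG/valP.
have vS g : Gamma g -> {h : gT | v h = g}.
  by move=> /sG gs; exists (SeqSub gs : subgroup_of cl).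
have gX (g : gT) : (v g ^+ #|gT| = 1)%g.
  by rewrite -vX -[#|gT|]cardsT expg_cardG ?inE.
have gT0 : (0 < #|gT|)%N by apply/card_gt0P; exists 1%g.
have [|pq pqP] := boolp.choice (P := fun (g : gT) (pq : P1 algC * P1 algC) => g != 1%g ->
    pq.1 != pq.2 /\ forall x, act (v g) x = x <-> x = pq.1 \/ x = pq.2).
  move=> g; have [->|gn1] := eqVneq g 1%g; first by exists (inf, inf).
  have vg1 : v g != 1%g by apply: contra gn1 => /eqP e; apply/eqP/vI; rewrite e v1.
  by have [xy xyP] := fixpoints_finite_order gT0 (gX g) vg1; exists xy.
(* The points with nontrivial stabilizer; they are finitely many, being the fixed points of the
   nontrivial elements. *)
pose X := flatten [seq [:: (pq g).1; (pq g).2] | g <- enum gT & g != 1%g].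
have XP x : x \in X <-> exists2 g : gT, g != 1%g & act (v g) x = x.
  split=> [/flatten_mapP[g]|[g g1' gx]].
    rewrite mem_filter => /andP[gn1 _] xg; exists g => //; have [_ gE] := pqP g gn1.
    by apply/gE; move: xg; rewrite !inE => /orP[] /eqP; [left|right].
  apply/flatten_mapP; exists g; first by rewrite mem_filter g1' mem_enum.
  have [_ gE] := pqP g g1'; have /gE[->|->] := gx; by rewrite !inE eqxx ?orbT.
pose T := seq_sub X.
(* Actions of a [finGroupType] are right actions, hence the inverse. The moved point is fixed by a
   conjugate element. *)
have toX (x : T) (g : gT) : act (v g)^-1%g (val x) \in X.
  have /XP[h h1 hx] := valP x; apply/XP; exists (conjg h g).
    by apply: contra h1 => /eqP e; apply/eqP/(@conjg_inj _ g); rewrite e conj1g.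
  have -> : v (conjg h g) = conjg (v h) (v g) by [].
  by rewrite act_conj hx.
pose toF (x : T) (g : gT) : T := SeqSub (toX x g).
have to1 : toF^~ 1%g =1 id by move=> x; apply: val_inj; rewrite /= v1 invg1 act1.
have toM x : act_morph toF x.
  by move=> g h; apply: val_inj; rewrite /= vM -actM -invMg.
pose to := TotalAction to1 toM.
have toE x g : val (to x g) = act (v g)^-1%g (val x) by [].
have fixE x g : to x g = x <-> act (v g) (val x) = val x.
  split=> [e|e]; first by rewrite -{1}e toE actKV.
  by apply: val_inj; rewrite toE -{1}e actK.
have card_gT : (1 < #|gT|)%N.
  rewrite -cardsT cardG_gt1; apply/trivgPn.
  have [h eh] := vS g1 Gg1; exists h; rewrite ?inE //.
  by apply: contra g1n => /eqP e; rewrite -eh e v1.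
have fix2 g : g != 1%g -> #|'Fix_to[g]%g| = 2.
  move=> gn1; have [pqn pqE] := pqP g gn1.
  have pX : (pq g).1 \in X by apply/XP; exists g => //; apply/pqE; left.
  have qX : (pq g).2 \in X by apply/XP; exists g => //; apply/pqE; right.
  transitivity #|[set (SeqSub pX : T); (SeqSub qX : T)]%SET|; last first.
    by rewrite cards2 (_ : _ == _ = false) //; apply/negP => /eqP [e];
      rewrite e eqxx in pqn.
  apply: eq_card => x; apply/afix1P/set2P => [/fixE/pqE|e].
    by case=> e; [left|right]; apply/val_inj.
  by apply/fixE/pqE; case: e => ->; [left|right].
have stab1 x : 'C[x | to]%g != 1%g.
  have /XP[g gn1 gx] := valP x; apply/trivgPn; exists g => //.
  by apply/astab1P/fixE.
have [x [n1 ns]] := special_orbit card_gT fix2 stab1.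
exists (val x), #|'C[x | to]%g|, #|orbit to [set: gT]%G x|; split=> //; split.
  exists [seq v g | g <- enum 'C[x | to]%g]; split.
  - by rewrite map_inj_uniq ?enum_uniq.
  - by rewrite size_map -cardE.
  - move=> g; split=> [/mapP[h]|[Gg gx]].
      by rewrite mem_enum => /astab1P/fixE hx ->.
    have [h eh] := vS g Gg; apply/mapP; exists h => //.
    by rewrite mem_enum; apply/astab1P/fixE; rewrite eh.
  - move=> _ /mapP[h hC ->]; rewrite mem_enum in hC.
    by rewrite -vX expg_cardG.
exists [seq val y | y <- enum (orbit to [set: gT]%G x)]; split.
- by rewrite map_inj_uniq ?enum_uniq //; apply: val_inj.
- by rewrite size_map -cardE.
- move=> q; split=> [/mapP[y]|[g Gg gx]].
    rewrite mem_enum => /orbitP[g _ <-] ->; exists (v g)^-1%g => //.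
    by rewrite -vV.
  have [h eh] := vS g Gg; apply/mapP; exists (to x h^-1%g).
    by rewrite mem_enum; apply/orbitP; exists h^-1%g; rewrite ?inE.
  by rewrite toE vV invgK eh gx.
Qed.

(** * Normal forms *)

Section Conjugation.
Variable G : groupType.
Implicit Types (A : set G) (g h : G).

Definition subgroup A :=
  [/\ A 1%g, forall g h, A g -> A h -> A (g * h)%g & forall g, A g -> A g^-1%g].

Definition conjset A h : set G := [set conjg g h | g in A]%classic.

Lemma conjsetP A h g : conjset A h g <-> A (conjg g h^-1)%g.
Proof.
split=> [[g' Ag' <-]|Ag]; first by rewrite conjgK.
by exists (conjg g h^-1)%g => //; rewrite conjgKV.
Qed.

Lemma conjset_conjg A h g : conjset A h (conjg g h) <-> A g.
Proof. by rewrite conjsetP conjgK. Qed.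

Lemma conjsetM A g h : conjset (conjset A g) h = conjset A (g * h)%g.
Proof.
by apply/seteqP; split=> x /conjsetP Ax; apply/conjsetP;
   move: Ax; rewrite conjsetP -conjgM invMg.
Qed.

Lemma conjset1 A : conjset A 1%g = A.
Proof.
by apply/seteqP; split=> x /=; rewrite conjsetP invg1 conjg1.
Qed.

Lemma subgroup_conj A h : subgroup A -> subgroup (conjset A h).
Proof.
case=> A1 AM AV; split=> [|x y|x]; rewrite !conjsetP.
- by rewrite conj1g.
- by rewrite conjMg; apply: AM.
- by rewrite conjVg; apply: AV.
Qed.

Lemma finite_subgroup_subgroup A : finite_subgroup A -> subgroup A.
Proof.
case=> _ cl; have [A1 _] := cl.
split=> [|g h /mem_set Ag /mem_set Ah|g /mem_set Ag]; first exact: set_mem.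
  by apply: set_mem; apply: (group_closedM cl).
by apply: set_mem; apply: (group_closedV cl).
Qed.

End Conjugation.

Lemma orbit_data_conj (Gamma : set (PGL2 algC)) p n k h :
  orbit_data Gamma p n k -> orbit_data (conjset Gamma h) (act h^-1%g p) n k.
Proof.
have conj_act g : act g p = p <-> act (conjg g h) (act h^-1%g p) = act h^-1%g p.
  by rewrite act_conj; split=> [->//|/act_inj].
move=> [[s [us sn sG sX]] [O [uO On OG]]]; split.
  exists [seq conjg g h | g <- s]; split.
  - by rewrite map_inj_uniq //; apply: conjg_inj.
  - by rewrite size_map.
  - move=> g; split=> [/mapP[g' /sG[Gg gp] ->]|[[g' Gg <-] gp]].
      by split; [apply/conjset_conjg|apply/conj_act].
    by apply: map_f; apply/sG; split=> //; apply/conj_act.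
  - by move=> _ /mapP[g /sX gn ->]; rewrite -conjXg gn conj1g.
exists [seq act h^-1%g q | q <- O]; split.
- by rewrite map_inj_uniq //; apply: act_inj.
- by rewrite size_map.
- move=> q; split=> [/mapP[q' /OG[g Gg <-] ->]|[_ [g Gg <-] <-]].
    by exists (conjg g h); [apply/conjset_conjg|rewrite act_conj].
  by rewrite act_conj; apply: map_f; apply/OG; exists g.
Qed.

Lemma aff_homX (K : fieldType) (a : K) k : a != 0 -> (aff a 0 ^+ k = aff (a ^+ k) 0)%g.
Proof.
move=> a0; elim: k => [|k IHk]; first by rewrite expg0 expr0 aff1.
by rewrite expgS IHk aff_mul ?expf_neq0 // mulr0 addr0 exprS.
Qed.

Definition stab_inf_hom (Gamma : set (PGL2 algC)) n :=
  forall g, Gamma g /\ act g inf = inf <-> homotheties n g.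

(** A nontrivial element fixing p has a second fixed point q; move p to infinity and q to 0.
    Triviality of commutators then makes the whole stabilizer fix 0, and counting yields all n
    homotheties. *)
Lemma normalize_stab (Gamma : set (PGL2 algC)) p n k :
    subgroup Gamma -> (1 < n)%N -> orbit_data Gamma p n k ->
  exists h, orbit_data (conjset Gamma h) inf n k /\ stab_inf_hom (conjset Gamma h) n.
Proof.
move=> sG n1 dG; have [[s [us sn sP sX]] _] := dG.
have n0 : (0 < n)%N by apply: ltnW.
have [g gs g1] : exists2 g, g \in s & g != 1%g.
  move: us sn; case: (s) => [|g [|g' s']] /=; first by move=> _ e; rewrite -e in n0.
    by move=> _ e; rewrite -e in n1.
  rewrite inE negb_or -!andbA => /and3P[gg' _ _] _.
  have [e|] := eqVneq g 1%g; last by exists g; rewrite ?mem_head.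
  by exists g'; rewrite ?inE ?eqxx ?orbT // -e eq_sym.
have [Gg gp] := (sP g).1 gs.
have [q pq gq] : exists2 q, p <> q & act g q = q.
  have [[a b] /= [ab fixg]] := fixpoints_finite_order n0 (sX g gs) g1.
  have /fixg [pE|pE] := gp; [exists b|exists a]; rewrite ?pE.
  - exact/eqP.
  - by apply/fixg; right.
  - by apply/eqP; rewrite eq_sym.
  - by apply/fixg; left.
have [h hp hq] := trans2 pq; exists h.
have hpV : act h^-1%g p = inf by rewrite -hp actK.
have hqV : act h^-1%g q = pt 0 1 by rewrite -hq actK.
have := orbit_data_conj h dG; rewrite hpV => dG'; split=> //.
have [G1 GM GV] := subgroup_conj h sG.
have [[s' [us' sn' sP' sX']] _] := dG'.
have [a a0 eg] : exists2 a, a != 0 & conjg g h = aff a 0.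
  by apply: fix_inf_0P; rewrite -?hpV -?hqV act_conj ?gp ?gq.
have a1 : 1 - a != 0.
  rewrite subr_eq0; apply: contra g1 => /eqP a1; apply/eqP/(@conjg_inj _ h).
  by rewrite eg -a1 aff1 conj1g.
have Gga : conjset Gamma h (aff a 0) by rewrite -eg; apply/conjset_conjg.
have sub x : x \in s' -> homotheties n x.
  move=> xs; have [Gx xi] := (sP' x).1 xs.
  have [a' [b [a0' ex]]] := fix_infP xi; rewrite ex in xs Gx xi *.
  have aa0 : a * a' != 0 by rewrite mulf_neq0.
  (* A commutator of affine maps is a translation, which has finite order only
     if it is trivial. *)
  have comm : (aff a' b * aff a 0 * (aff a 0 * aff a' b)^-1 = aff 1 ((1 - a) * b))%g.
    rewrite !aff_mul // affV // aff_mul ?mulf_neq0 ?invr_eq0 //.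
    have -> : a' * a * (a * a')^-1 = 1 by rewrite [a' * a]mulrC mulfV.
    by congr aff; field; rewrite a0 a0'.
  have : aff 1 ((1 - a) * b) \in s'.
    apply/sP'; rewrite act_aff_inf ?oner_neq0 //; split=> //; rewrite -comm.
    exact: GM _ _ (GM _ _ Gx Gga) (GV _ (GM _ _ Gga Gx)).
  move/sX'/(aff_translation n0)/eqP; rewrite mulf_eq0 (negPf a1) => /eqP b0.
  exists a'; last by rewrite b0.
  have := sX' _ xs; rewrite b0 aff_homX // -aff1.
  by move/(aff_inj (expf_neq0 _ a0') (oner_neq0 _)) => [].
have [z pz] := C_prim_root_exists n0.
(* The stabilizer has n elements, all among the n homotheties listed in R. *)
pose R := [seq aff (z ^+ i) 0 | i : 'I_n].
have sR : {subset s' <= R}.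
  move=> x /sub[c cn ->]; have [i ->] := prim_rootP pz cn.
  by apply/mapP; exists i; rewrite ?mem_enum.
have szR : (size R <= size s')%N by rewrite size_map size_enum_ord sn'.
have [_ sRE] := uniq_min_size us' sR szR.
move=> x; split=> [/sP'/sub //|[c cn ->]]; apply/sP'; rewrite sRE.
by have [i ->] := prim_rootP pz cn; apply/mapP; exists i; rewrite ?mem_enum.
Qed.

(** Homotheties commute with each other and fix infinity, so rescaling preserves this normal
    form. *)
Lemma conjset_hom (Gamma : set (PGL2 algC)) n (l : algC) : (0 < n)%N -> l != 0 ->
  stab_inf_hom Gamma n -> stab_inf_hom (conjset Gamma (aff l 0)) n.
Proof.
move=> n0 l0 H g; set h := aff l 0.
have hi : act h inf = inf by apply: act_aff_inf.
have hVi : act h^-1%g inf = inf by rewrite -[X in act _ X]hi actK.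
have homJ x : homotheties n x -> conjg x h = x.
  case=> a an ->; have a0 := unity_root_neq0 n0 an.
  by apply/conjg_fixP/commgP; rewrite /commute !aff_mul // mulr0 addr0 mulrC mulr0 addr0.
split=> [[[g' Gg' <-]] gi|gn].
  have g'i : act g' inf = inf by apply: (@act_inj _ h^-1%g); rewrite -act_conj hVi.
  by have /H gn : Gamma g' /\ act g' inf = inf by []; rewrite homJ.
have [Gg gi] := (H g).2 gn; split=> //.
by rewrite -(homJ _ gn); apply/conjset_conjg.
Qed.

Lemma one_point_orbit (Gamma : set (PGL2 algC)) n :
  stab_inf_hom Gamma n -> subgroup Gamma -> orbit_data Gamma inf n 1 -> Gamma =
    homotheties n.
Proof.
move=> H [G1 _ _] [_ [O [uO sO OP]]]; apply/seteqP; split=> g; last by case/H.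
move=> Gg; apply/H; split=> //.
have iO : inf \in O by apply/OP; exists 1%g; rewrite ?act1.
have gO : act g inf \in O by apply/OP; exists g.
case: (O) sO iO gO => [|x [|//]] // _; rewrite !inE => /eqP -> /eqP //.
Qed.

Lemma two_point_orbit (Gamma : set (PGL2 algC)) n :
    (1 < n)%N -> stab_inf_hom Gamma n -> subgroup Gamma -> orbit_data Gamma inf n 2 ->
  exists h, conjset Gamma h = dihedral n.
Proof.
move=> n1 H sG [_ [O [uO sO OP]]]; have [G1 GM GV] := sG.
have n0 : (0 < n)%N by apply: ltnW.
have iO : inf \in O by apply/OP; exists 1%g; rewrite ?act1.
have [q qO qi] : exists2 q, q \in O & q != inf.
  case: (O) uO sO => [|x [|y [|//]]] //; rewrite /= inE => /andP[xy _] _.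
  have [e|xi] := eqVneq x inf; last by exists x; rewrite ?mem_head.
  by exists y; rewrite ?inE ?eqxx ?orbT // -e eq_sym.
have [_ OE] : size [:: inf; q] = size O /\ [:: inf; q] =i O.
  case: (@uniq_min_size _ [:: inf; q] O) => [||| -> e]; rewrite ?sO //=.
    by rewrite inE andbT eq_sym.
  by move=> x; rewrite !inE => /orP[] /eqP ->.
have O2 x : x \in O -> x = inf \/ x = q by rewrite -OE !inE => /orP[] /eqP; [left|right].
have [g Gg gq] := (OP q).1 qO.
have Oact x h : x \in O -> Gamma h -> act h x \in O.
  by move=> /OP[h' Gh' <-] Gh; apply/OP; exists (h * h')%g; [apply: GM|rewrite actM].
have [z pz] := C_prim_root_exists n0.
have zn := prim_expr_order pz; have z0 := unity_root_neq0 n0 zn.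
have [Gz _] := (H (aff z 0)).2 (ex_intro2 _ _ z zn erefl).
(* A homothety of ratio z <> 1 fixes infinity, hence also the other point q of the orbit. *)
have q0 : q = pt 0 1.
  case: (point_cases q) => [e|[y qy]]; first by rewrite e eqxx in qi.
  have := O2 _ (Oact _ _ qO Gz);
    rewrite qy act_aff // addr0 => -[/pt_neq_inf //|/pt_inj/eqP].
  rewrite -subr_eq0 -{2}[y]mul1r -mulrBl mulf_eq0 subr_eq0 => /orP[/eqP z1|/eqP -> //].
  by move: (prim_order_dvd pz 1); rewrite expr1 z1 eqxx dvdn1 => /eqP n1';
    rewrite n1' in n1.
(* After composition with [swap], x fixes both infinity and 0. *)
have to0 x : act x inf = pt 0 1 -> Gamma x -> exists2 c, c != 0 & x = (aff c 0 * swap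
  algC)%g.
  move=> x0 Gx; have sxi : act (swap algC * x)%g inf = inf by rewrite actM x0 act_swap
    ?nz01.
  have sx0 : act (swap algC * x)%g (pt 0 1) = pt 0 1.
    have : act x (pt 0 1) \in O by rewrite Oact // -q0.
    case/O2 => [e|e]; first by rewrite actM e act_swap ?nz10.
    by case: (@pt_neq_inf algC 0); apply: (@act_inj _ x); rewrite e q0 x0.
  have [c c0 e] := fix_inf_0P sxi sx0; exists c^-1; first by rewrite invr_eq0.
  by rewrite -swap_aff // -e mulgA swapK mul1g.
have [c c0 ec] := to0 g (etrans gq q0) Gg.
(* Conjugating z |-> c / z by z |-> l z gives z |-> c / (l^2 z), which is [swap]. *)
pose l := sqrtC c; have l0 : l != 0 by rewrite sqrtC_eq0.
exists (aff l 0); have H' := conjset_hom n0 l0 H.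
have [G1' GM' GV'] := subgroup_conj (aff l 0) sG.
have Gs : conjset Gamma (aff l 0) (swap algC).
  have -> : swap algC = conjg g (aff l 0).
    rewrite ec /conjg -!mulgA [(swap _ * _)%g]swap_aff // affV // mulgA aff_mul
      ?invr_eq0 //.
    rewrite mulgA aff_mul ?mulf_neq0 ?invr_eq0 // mul0r oppr0 !mulr0 !addr0.
    have -> : l^-1 * c * l^-1 = 1 by rewrite -(sqrtCK c) -/l; field.
    by rewrite aff1 mul1g.
  exact/conjset_conjg.
have hVi : act (aff l 0)^-1%g inf = inf by rewrite -[X in act _ X](act_aff_inf 0 l0) actK.
have hV0 : act (aff l 0)^-1%g (pt 0 1) = pt 0 1.
  by rewrite affV // act_aff ?invr_eq0 // mul0r oppr0 mulr0 addr0.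
apply/seteqP; split=> x.
  move=> Gx; have [xi|x0] : act x inf = inf \/ act x inf = pt 0 1.
  - case: Gx => x' Gx' <-; rewrite -[X in act _ X]hVi act_conj.
    have /O2 : act x' inf \in O by rewrite Oact.
    by rewrite q0 => -[->|->]; [left|right].
  - by have /H'[a an ->] : conjset Gamma (aff l 0) x /\ act x inf = inf by [];
    exists a => //; left.
  have /H'[a an ea] : conjset Gamma (aff l 0) (swap algC * x)%g /\ act (swap algC *
    x)%g inf = inf.
    by split; [apply: GM'|rewrite actM x0 act_swap ?nz01].
  exists a^-1; first by rewrite exprVn an invr1.
  by right; rewrite -swap_aff ?(unity_root_neq0 n0 an) // -ea mulgA swapK mul1g.
case=> a an xa; have [Ga _] := (H' (aff a 0)).2 (ex_intro2 _ _ a an erefl).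
by case: xa => -> //; apply: GM'.
Qed.

(** * Polyhedral groups *)

Definition root_poly (R : nzRingType) (S : seq R) : {poly R} := \prod_(z <- S) ('X - z%:P).

Section RootPoly.
Variable K : closedFieldType.
Implicit Types (S : seq K) (a l x y : K).

Lemma root_poly_horner S x : (root_poly S).[x] = \prod_(z <- S) (x - z).
Proof. by rewrite horner_prod; apply: eq_bigr => z _; rewrite hornerXsubC. Qed.

Lemma prod_scale S a x : \prod_(z <- S) (a * x - a * z) = a ^+ size S * \prod_(z <- S)
  (x - z).
Proof.
elim: S => [|z S IHS]; first by rewrite !big_nil mulr1.
by rewrite !big_cons IHS -mulrBr /= exprS mulrACA.
Qed.

Lemma poly_scale_coef (p : {poly K}) a (q : {poly K}) :
  (forall x, q.[x] = p.[a * x]) -> forall i, q`_i = p`_i * a ^+ i.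
Proof.
move=> e i; have -> : q = \poly_(j < size p) (p`_j * a ^+ j).
  apply: poly_ext => x; rewrite e horner_poly horner_coef; apply: eq_bigr => j _.
  by rewrite exprMn mulrA.
by rewrite coef_poly; case: ltnP => // hi; rewrite nth_default // mul0r.
Qed.

(** If P has the roots S, then P(l x) / l^m, with m the size of S, has the roots z / l. *)
Lemma root_poly_scale S l i : l != 0 ->
  (root_poly [seq z / l | z <- S])`_i = l ^- size S * ((root_poly S)`_i * l ^+ i).
Proof.
move=> l0; set Q := root_poly _.
have <- : (l ^+ size S *: Q)`_i = (root_poly S)`_i * l ^+ i.
  apply: poly_scale_coef => x; rewrite hornerZ !root_poly_horner.
  have := prod_scale [seq z / l | z <- S] l x.
  rewrite size_map => <-; rewrite big_map; apply: eq_bigr => z _.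
  by rewrite mulrCA divff // mulr1.
by rewrite coefZ mulrA mulVf ?expf_neq0 // mul1r.
Qed.

(** Multiplication by a permutes the roots, so P(a x) = a^m P(x) for m the size of S. *)
Lemma root_poly_stable S a i : a != 0 -> uniq S -> {in S, forall z, a * z \in S} ->
  (root_poly S)`_i * a ^+ i = a ^+ size S * (root_poly S)`_i.
Proof.
move=> a0 uS aS; have pS := mem_uniq_perm_eq (mulfI a0) uS aS.
rewrite -coefZ; symmetry; apply: poly_scale_coef => x.
by rewrite hornerZ !root_poly_horner -[RHS](perm_big _ pS) /= big_map prod_scale.
Qed.

End RootPoly.

Definition points (K : fieldType) (S : seq K) : seq (P1 K) := inf :: [seq pt z 1 | z <- S].

Lemma mem_points (K : fieldType) (S : seq K) z : (pt z 1 \in points S) = (z \in S).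
Proof.
rewrite inE; have /= -> := mem_map (@pt_inj K) S z.
by case: eqP => // /pt_neq_inf.
Qed.

(* The orbit of infinity consists of infinity and S. *)
Definition vertex_figure (Gamma : set (PGL2 algC)) n (S : seq algC) :=
  [/\ subgroup Gamma, stab_inf_hom Gamma n, uniq S &
    forall q, q \in points S <-> exists2 g, Gamma g & act g inf = q].

Lemma orbit_vertex_figure (Gamma : set (PGL2 algC)) n k :
    subgroup Gamma -> stab_inf_hom Gamma n -> orbit_data Gamma inf n k ->
  exists2 S, vertex_figure Gamma n S & size S = k.-1.
Proof.
move=> sG H [_ [O [uO sO OP]]]; have [G1 _ _] := sG.
have iO : inf \in O by apply/OP; exists 1%g; rewrite ?act1.
(* The affine coordinate, with junk value 0 at infinity, which is removed from O before use. *)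
pose c (p : P1 algC) := xcoord p / ycoord p.
have cE p : p != inf -> pt (c p) 1 = p.
  move=> pi; rewrite -pt_aff ?pt_coords //; apply: contra pi => /eqP y0.
  have := coords_neq0 p; rewrite y0 eqxx orbF => x0.
  by rewrite -(pt_coords p) y0 pt_inf.
have cO : {in rem inf O, forall p, pt (c p) 1 = p}.
  by move=> p; rewrite mem_rem_uniq // inE => /andP[/cE].
exists [seq c p | p <- rem inf O]; last by rewrite size_map size_rem // sO.
split=> //.
  rewrite map_inj_in_uniq ?rem_uniq // => p q pO qO e.
  by rewrite -(cO p pO) -(cO q qO) e.
move=> q; rewrite -OP /points -map_comp.
have -> : [seq (pt (K := algC))^~ 1 (c p) | p <- rem inf O] = rem inf O.
  by rewrite -[RHS]map_id; apply/eq_in_map.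
by rewrite (perm_mem (perm_to_rem iO)).
Qed.

Section VertexFigure.
Variables (Gamma : set (PGL2 algC)) (n : nat) (S : seq algC).
Hypotheses (n0 : (0 < n)%N) (VF : vertex_figure Gamma n S).

Lemma vertex_figure_act g p : Gamma g -> p \in points S -> act g p \in points S.
Proof.
have [[_ GM _] _ _ OP] := VF; move=> Gg /OP[h Gh <-].
by apply/OP; exists (g * h)%g; [apply: GM | rewrite actM].
Qed.

Lemma vertex_figure_hom a z : a ^+ n = 1 -> z \in S -> a * z \in S.
Proof.
move=> an zS; have a0 := unity_root_neq0 n0 an.
have [_ H _ _] := VF; have [Ga _] := (H (aff a 0)).2 (ex_intro2 _ _ a an erefl).
rewrite -mem_points -[a * z]addr0 -act_aff //; apply: vertex_figure_act => //.
by rewrite mem_points.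
Qed.

(** The roots are stable under a primitive n-th root of unity z, so a nonzero coefficient of degree
    i forces z^i = z^m, where m is the size of S. *)
Lemma vertex_figure_coef i : (i %% n)%N != (size S %% n)%N -> (root_poly S)`_i = 0.
Proof.
have [_ _ uS _] := VF; have [z pz] := C_prim_root_exists n0.
have zn := prim_expr_order pz; have z0 := unity_root_neq0 n0 zn.
rewrite -(eq_prim_root_expr pz) => h; apply/eqP; apply: contraNT h => P0.
have := @root_poly_stable _ S z i z0 uS (fun x => @vertex_figure_hom z x zn).
by rewrite mulrC => /(mulIf P0) ->.
Qed.

Lemma vertex_figure_scale l : l != 0 ->
  vertex_figure (conjset Gamma (aff l 0)) n [seq z / l | z <- S].
Proof.
move=> l0; have [sG H uS OP] := VF; split.
- exact: subgroup_conj.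
- exact: conjset_hom.
- by rewrite map_inj_uniq //; apply: mulIf; rewrite invr_eq0.
have hV z : act (aff l 0)^-1%g (pt z 1) = pt (z / l) 1.
  by rewrite affV // act_aff ?invr_eq0 // mul0r oppr0 addr0 mulrC.
have hVi : act (aff l 0)^-1%g inf = inf by rewrite -[X in act _ X](act_aff_inf 0 l0) actK.
have -> : points [seq z / l | z <- S] = [seq act (aff l 0)^-1%g q | q <- points S].
  by rewrite /= hVi; congr (_ :: _); elim: (S) => //= z s ->; rewrite hV.
move=> q; split=> [/mapP[p /OP[g Gg <-] ->]|[_ [g Gg <-] <-]].
  by exists (conjg g (aff l 0)); [apply/conjset_conjg | rewrite -act_conj hVi].
by rewrite -[X in act _ X]hVi act_conj map_f //; apply/OP; exists g.
Qed.

(** The two coefficient conditions show that Gamma is the full stabilizer: the vanishing one puts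
    the barycenter of S at 0, the nonvanishing one bounds the ratios of homotheties preserving S. *)
Lemma vertex_figure_realizable (p : {poly rat}) :
    (n <= size S)%N -> (1 < size S)%N -> root_poly S = map_poly ratC p ->
    p`_(size S).-1 = 0 -> p`_(size S - n) != 0 ->
  realizable Gamma.
Proof.
move=> nS S1 PS p1 pn; have [[G1 GM GV] H uS OP] := VF.
suff -> : Gamma = stab (points S) by apply: (realizable_stab S1 uS (esym PS)).
apply/seteqP; split=> [g Gg q|g gS]; first exact: vertex_figure_act.
(* Since Gamma is transitive on the points, g may be corrected by some h in Gamma so as to fix
   infinity. *)
have /OP[h Gh hg] : act g inf \in points S by apply: gS; rewrite inE eqxx.
have tS : stab (points S) (h^-1 * g)%g.
  by move=> q qS; rewrite actM; apply: vertex_figure_act; [apply: GV | apply: gS].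
have ti : act (h^-1 * g)%g inf = inf by rewrite actM -hg actK.
have [a [b [a0 e]]] := fix_infP ti; rewrite e in tS.
have abS z : z \in S -> a * z + b \in S.
  by move=> zS; rewrite -mem_points -act_aff //; apply: tS; rewrite mem_points.
have sum0 : \sum_(z <- S) z = 0.
  apply/eqP; rewrite -oppr_eq0 -coefPn_prod_XsubC -?lt0n ?(ltnW S1) //.
  by rewrite -/(root_poly S) PS coef_map /= p1 raddf0.
(* Summing a z + b over S gives the sum of S again, so b times the size of S is 0. *)
have b0 : b = 0.
  have abI : injective (fun z => a * z + b) by move=> z w /addIr/(mulfI a0).
  have pS := mem_uniq_perm_eq abI uS abS.
  have : \sum_(z <- S) (a * z + b) = \sum_(z <- S) z.
    by rewrite -[RHS](perm_big _ pS) big_map.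
  rewrite big_split /= -mulr_sumr sum0 mulr0 add0r big_const_seq count_predT.
  move/eqP; rewrite iter_addr addr0 mulrn_eq0 eqn0Ngt (ltnW S1) => /eqP //.
suff an : a ^+ n = 1.
  have [Gt _] := (H (aff a 0)).2 (ex_intro2 _ _ a an erefl).
  by rewrite -[g](mulKVg h) e b0; apply: GM.
have aS z : z \in S -> a * z \in S by move=> /abS; rewrite b0 addr0.
(* In degree m - n, for m the size of S, stability reads r a^(m-n) = a^m r with r <> 0. *)
have := @root_poly_stable _ S a (size S - n)%N a0 uS aS.
rewrite PS coef_map /= -{3}(subnK nS) exprD; set r := ratr _; set u := a ^+ (_ - _).
have ru : r * u != 0 by rewrite mulf_neq0 ?fmorph_eq0 ?expf_neq0.
by move=> eru; apply: (mulfI ru); rewrite mulr1 [RHS]eru; ring.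
Qed.

End VertexFigure.

Lemma coef_linear_exp (K : fieldType) (a e : K) n i : (i <= n)%N ->
  ((a%:P + e *: 'X) ^+ n)`_i = a ^+ (n - i) * e ^+ i *+ 'C(n, i).
Proof.
move=> ni; rewrite exprDn coef_sum (bigD1 (inord i)) //= inordK ?ltnS //.
have E j : ((a%:P ^+ (n - j) * (e *: 'X) ^+ j) *+ 'C(n, j))`_i =
    a ^+ (n - j) * e ^+ j * (i == j)%:R *+ 'C(n, j).
  by rewrite coefMn -polyC_exp exprZn coefCM coefZ coefXn mulrA.
rewrite E eqxx mulr1 big1 ?addr0 // => j jn; rewrite E.
suff /negPf -> : i != j by rewrite mulr0 mul0rn.
by apply: contra jn => /eqP ->; apply/eqP/val_inj; rewrite /= inordK // ltn_ord.
Qed.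

Lemma root_poly_coef_size (K : fieldType) (S : seq K) : (root_poly S)`_(size S) = 1.
Proof.
have /monicP := monic_prod_XsubC S xpredT id.
by rewrite lead_coefE size_prod_XsubC.
Qed.

Lemma root_poly_eq (k K : fieldType) (iota : {rmorphism k -> K}) (S : seq K) (p : {poly
  k}) :
    (size p <= (size S).+1)%N ->
    (forall i, (i <= size S)%N -> (root_poly S)`_i = iota p`_i) ->
  root_poly S = map_poly iota p.
Proof.
move=> sp e; apply/polyP => i; rewrite coef_map; have [/e //|hi] := leqP i (size S).
rewrite (nth_default _ (leq_trans sp hi)) raddf0.
by rewrite nth_default // size_prod_XsubC.
Qed.

(** Here 0 is a root, and a simple one. *)
Lemma root_poly_coef01 (K : fieldType) (S : seq K) :
  uniq S -> (root_poly S)`_0 = 0 -> (root_poly S)`_1 != 0.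
Proof.
move=> uS P0; have S0 : 0 \in S.
  have : root (root_poly S) 0 by rewrite rootE horner_coef0 P0.
  by rewrite root_prod_XsubC.
rewrite /root_poly (big_rem 0) //= subr0 coefXM /= -horner_coef0 -rootE root_prod_XsubC.
by rewrite mem_rem_uniqF.
Qed.

(* Moving a nonzero root a to infinity by an element of Gamma must give the same
   polynomial P up to an affine change of variable, with coefficients 0 in
   degrees 10 and 9 after centering; this reads 15 P''(a)^2 = 22 P'(a) P'''(a). *)
Lemma icosahedral_relation (Gamma : set (PGL2 algC)) (S : seq algC) :
    vertex_figure Gamma 5 S -> size S = 11%N ->
  (root_poly S)`_6 ^+ 2 = - (121%:R * (root_poly S)`_1).
Proof.
move=> VF sS; have [_ _ uS OP] := VF.
set al := (root_poly S)`_6; set be := (root_poly S)`_1.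
(* Only exponents congruent to 11 modulo 5 occur: 11, 6 and 1. *)
have PE t : \prod_(z <- S) (t - z) = t ^+ 11 + al * t ^+ 6 + be * t.
  rewrite -root_poly_horner horner_coef size_prod_XsubC sS !big_ord_recr big_ord0 /=.
  have c0 i : (i %% 5 != 1)%N -> (root_poly S)`_i = 0.
    by move=> hi; apply: (vertex_figure_coef (isT : (0 < 5)%N) VF); rewrite sS.
  rewrite !(c0 0, c0 2, c0 3, c0 4, c0 5, c0 7, c0 8, c0 9, c0 10)%N //.
  by rewrite -{1}sS root_poly_coef_size -/al -/be; ring.
have [a aS a0] : exists2 a, a \in S & a != 0.
  move: uS sS; case: (S) => [|x [|y s]] //= /andP[xy _] _.
  have [e|] := eqVneq x 0; last by exists x; rewrite ?mem_head.
  exists y; first by rewrite !inE eqxx orbT.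
  by apply: contra xy => /eqP ->; rewrite e mem_head.
have [g Gg] : exists2 g, Gamma g & act g inf = pt a 1 by apply/OP; rewrite mem_points.
have gS := fun q => @vertex_figure_act _ _ _ VF g q Gg; move: gS.
elim/mob_ind: g Gg => A B C D det Gg gS; rewrite act_mob ?nz10 // !mulr1 !mulr0 !addr0.
have AC0 : (A != 0) || (C != 0).
  by rewrite -negb_and; apply: contra det => /andP[/eqP-> /eqP->];
    rewrite mul0r mulr0 subr0.
move/eqP; rewrite pt_eqE ?nz01 // mulr1 => /eqP AE.
have C0 : C != 0 by apply: contraTneq AC0 => C0; rewrite AE C0 mulr0 eqxx.
(* As A = a C, the determinant of g is - C e. *)
set e := B - a * D; have e0 : e != 0.
  apply: contra det; rewrite subr_eq0 => /eqP BE.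
  by rewrite AE BE subr_eq0; apply/eqP; ring.
have [k0 k00 kE] := wedge_aff S.
have uZ : uniq (points S).
  rewrite /= map_inj_uniq ?uS ?andbT; last exact: pt_inj.
  by apply/mapP => -[z _ ez]; apply: (@pt_neq_inf _ z).
have [k EE] := prod_wedge_act det uZ gS.
have {kE EE} inv x y : (C * x + D * y) * \prod_(z <- S) (A * x + B * y - z * (C * x + D
  * y)) =
    k * (y * \prod_(z <- S) (x - z * y)).
  by rewrite !kE EE; ring.
(* For x = c + d u, the point [x : u] is sent by g to [a + e u : 1]. *)
pose c := C^-1; pose d := - (D / C); have c0 : c != 0 by rewrite invr_eq0.
pose L : {poly algC} := c%:P + d *: 'X; pose M : {poly algC} := a%:P + e *: 'X.
(* This is P(a + e u) = k u^12 P((c + d u) / u) with denominators cleared. Below degree 6 the right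
   side reduces to k u (c + d u)^11. *)
have key : M ^+ 11 + al *: M ^+ 6 + be *: M =
    k *: ('X * L ^+ 11) + 'X^6 * (k *: (al *: L ^+ 6 + be *: (L * 'X^5))).
  apply: poly_ext => u; pose x := c + d * u.
  have ME : M.[u] = a + e * u by rewrite hornerD hornerC hornerZ hornerX.
  have LE : L.[u] = x by rewrite hornerD hornerC hornerZ hornerX.
  clearbody L M; rewrite !(hornerD, hornerZ, hornerM, horner_exp, hornerX) ME LE.
  have := inv x u; have -> : C * x + D * u = 1 by rewrite /x /c /d; field.
  have -> : A * x + B * u = a + e * u by rewrite AE /x /c /d /e; field.
  under eq_bigr do rewrite mulr1; rewrite mul1r PE => ->.
  have [->|u0] := eqVneq u 0; first by rewrite !mul0r !mulr0; ring.
  have -> : \prod_(z <- S) (x - z * u) = u ^+ 11 * \prod_(z <- S) (x / u - z).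
    rewrite -sS -prod_scale; apply: eq_bigr => z _.
    by rewrite mulrCA divff // mulr1 mulrC.
  by rewrite PE; field.
have LC n i : (i <= n)%N -> (L ^+ n)`_i = _ := @coef_linear_exp _ c d n i.
have MC n i : (i <= n)%N -> (M ^+ n)`_i = _ := @coef_linear_exp _ a e n i.
have M1 i : M`_i = a *+ (i == 0)%N + e *+ (i == 1)%N.
  by rewrite coefD coefC coefZ coefX mulr_natr; case: i.
clearbody L M.
have coefk i := congr1 (fun p : {poly algC} => p`_i) key.
move: (coefk 0%N) (coefk 1%N) (coefk 2%N) (coefk 3%N).
rewrite !(coefD, coefZ, coefXM, coefXnM) /= !MC // !LC // !M1 /=.
have [-> -> -> ->] : [/\ 'C(11, 1) = 11, 'C(11, 2) = 55, 'C(11, 3) = 165 & 'C(6, 1) =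
  6]%N by [].
have [-> -> -> ->] : [/\ 'C(6, 2) = 15, 'C(6, 3) = 20, 'C(11, 0) = 1 & 'C(6, 0) = 1]%N
  by [].
rewrite !subSS !subn0 => E0 E1 E2 E3.
have bE : be = - (a ^+ 10 + al * a ^+ 5).
  apply/eqP; rewrite -subr_eq0 opprK; apply/eqP/(mulfI a0).
  by rewrite mulr0 -[RHS](mulr0 k) -[RHS]addr0 -E0; ring.
(* By the expansion of k u (c + d u)^11, the coefficients in degrees 1, 2, 3 are k c^11, 11 k c^10 d
   and 55 k c^9 d^2; eliminating k, c, d gives 5 E2^2 = 11 E1 E3. *)
have rel : 5%:R * (55%:R * a ^+ 9 * e ^+ 2 + 15%:R * al * a ^+ 4 * e ^+ 2) ^+ 2 =
    11%:R * (11%:R * a ^+ 10 * e + 6%:R * al * a ^+ 5 * e + be * e) *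
      (165%:R * a ^+ 8 * e ^+ 3 + 20%:R * al * a ^+ 3 * e ^+ 3).
  have -> : 55%:R * a ^+ 9 * e ^+ 2 + 15%:R * al * a ^+ 4 * e ^+ 2 = 11%:R * k * c ^+
    10 * d.
    by transitivity (k * (c ^+ 10 * d ^+ 1 *+ 11) + 0); [rewrite -E2|]; ring.
  have -> : 11%:R * a ^+ 10 * e + 6%:R * al * a ^+ 5 * e + be * e = k * c ^+ 11.
    by transitivity (k * (c ^+ 11 * d ^+ 0 *+ 1) + 0); [rewrite -E1|]; ring.
  have -> : 165%:R * a ^+ 8 * e ^+ 3 + 20%:R * al * a ^+ 3 * e ^+ 3 = 55%:R * k * c ^+
    9 * d ^+ 2.
    by transitivity (k * (c ^+ 9 * d ^+ 2 *+ 55) + 0); [rewrite -E3|]; ring.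
  by ring.
(* With [be] eliminated by P(a) = 0, the two sides of [rel] differ by this factor times al^2 + 121
   be. *)
have nz : 25%:R * a ^+ 8 * e ^+ 4 != 0 :> algC by rewrite !mulf_neq0 ?expf_neq0 ?pnatr_eq0.
apply: (mulfI nz); apply/eqP; rewrite -subr_eq0; apply/eqP.
move/eqP: rel; rewrite -subr_eq0 => /eqP <-; rewrite bE; ring.
Qed.

(** The exponents are multiples of 3, so P = z^3 + P_0 with P_0 <> 0; a cube root of - P_0 rescales
    it to z^3 - 1. *)
Lemma tetrahedral (Gamma : set (PGL2 algC)) (S : seq algC) :
  vertex_figure Gamma 3 S -> size S = 3%N -> exists h, realizable (conjset Gamma h).
Proof.
move=> VF sS; have [_ _ uS _] := VF; set P := root_poly S.
have c0 i : (i %% 3 != 0)%N -> P`_i = 0.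
  by move=> hi; apply: (vertex_figure_coef (isT : (0 < 3)%N) VF); rewrite sS.
have P3 : P`_3 = 1 by rewrite -{1}sS root_poly_coef_size.
have P0 : P`_0 != 0.
  by apply/eqP => P0; have := root_poly_coef01 uS P0; rewrite -/P c0 ?eqxx.
pose l := 3.-root (- P`_0); have l3 : l ^+ 3 = - P`_0 by rewrite rootCK.
have l0 : l != 0 by rewrite rootC_eq0 // oppr_eq0.
exists (aff l 0); have VF' := vertex_figure_scale (isT : (0 < 3)%N) VF l0.
have sS' : size [seq z / l | z <- S] = 3%N by rewrite size_map.
have realV := vertex_figure_realizable VF' (p := 'X^3 - 1); rewrite sS' in realV.
have PE : [/\ P`_0 = - l ^+ 3, P`_1 = 0 & P`_2 = 0].
  by split; [rewrite l3 opprK | apply: c0 | apply: c0].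
apply: realV => //.
- apply: root_poly_eq => [|i]; first by rewrite sS' size_XnsubC.
  rewrite sS' root_poly_scale // sS -/P !coefE; have [E0 E1 E2] := PE.
  case: i => [|[|[|[|//]]]] _ /=; rewrite ?(E0, E1, E2, P3) ?raddfB ?raddf0 ?rmorph1 /=;
    by field.
- by rewrite !coefE.
- by rewrite !coefE.
Qed.

(** The exponents are 1 modulo 4, so P = z^5 + P_1 z; a fourth root of - P_1 rescales it to z^5 -
    z. *)
Lemma octahedral (Gamma : set (PGL2 algC)) (S : seq algC) :
  vertex_figure Gamma 4 S -> size S = 5%N -> exists h, realizable (conjset Gamma h).
Proof.
move=> VF sS; have [_ _ uS _] := VF; set P := root_poly S.
have c0 i : (i %% 4 != 1)%N -> P`_i = 0.
  by move=> hi; apply: (vertex_figure_coef (isT : (0 < 4)%N) VF); rewrite sS.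
have P5 : P`_5 = 1 by rewrite -{1}sS root_poly_coef_size.
have P1 : P`_1 != 0 by apply: root_poly_coef01 => //; apply: c0.
pose l := 4.-root (- P`_1); have l4 : l ^+ 4 = - P`_1 by rewrite rootCK.
have l0 : l != 0 by rewrite rootC_eq0 // oppr_eq0.
exists (aff l 0); have VF' := vertex_figure_scale (isT : (0 < 4)%N) VF l0.
have sS' : size [seq z / l | z <- S] = 5%N by rewrite size_map.
have realV := vertex_figure_realizable VF' (p := 'X^5 - 'X); rewrite sS' in realV.
have PE : [/\ P`_1 = - l ^+ 4, P`_0 = 0, P`_2 = 0, P`_3 = 0 & P`_4 = 0].
  by split; [rewrite l4 opprK | apply: c0 | apply: c0 | apply: c0 | apply: c0].
apply: realV => //.
- apply: root_poly_eq => [|i].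
    by rewrite sS' size_polyDl size_polyXn // size_polyN size_polyX.
  rewrite sS' root_poly_scale // sS -/P !coefE; have [E1 E0 E2 E3 E4] := PE.
  case: i => [|[|[|[|[|[|//]]]]]] _ /=;
    rewrite ?(E0, E1, E2, E3, E4, P5) ?raddfB ?raddf0 ?rmorph1 /=;
    by field.
- by rewrite !coefE.
- by rewrite !coefE.
Qed.

(** The scale l is chosen to turn the coefficient of z^6 into 11; [icosahedral_relation] then gives
    P_1 = - l^10, so the coefficient of z becomes -1. *)
Lemma icosahedral (Gamma : set (PGL2 algC)) (S : seq algC) :
  vertex_figure Gamma 5 S -> size S = 11%N -> exists h, realizable (conjset Gamma h).
Proof.
move=> VF sS; have [_ _ uS _] := VF; set P := root_poly S.
have c0 i : (i %% 5 != 1)%N -> P`_i = 0.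
  by move=> hi; apply: (vertex_figure_coef (isT : (0 < 5)%N) VF); rewrite sS.
have P11 : P`_11 = 1 by rewrite -{1}sS root_poly_coef_size.
have P1 : P`_1 != 0 by apply: root_poly_coef01 => //; apply: c0.
have rel := icosahedral_relation VF sS; rewrite -/P in rel.
(* Otherwise the relation would give P_1 = 0, making 0 a multiple root. *)
have P6 : P`_6 != 0.
  by apply: contraNneq P1 => P60; rewrite -oppr_eq0 -(mulrI_eq0 _ (mulfI (_ : 121%:R != 0)))
    ?pnatr_eq0 // mulrN -rel P60 expr0n.
pose l := 5.-root (P`_6 / 11%:R); have l5 : l ^+ 5 = P`_6 / 11%:R by rewrite rootCK.
have l0 : l != 0 by rewrite rootC_eq0 // mulf_neq0 ?invr_eq0 ?pnatr_eq0.
exists (aff l 0); have VF' := vertex_figure_scale (isT : (0 < 5)%N) VF l0.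
have sS' : size [seq z / l | z <- S] = 11%N by rewrite size_map.
have realV := vertex_figure_realizable VF' (p := 'X^11 + (11%:R *: 'X^6 - 'X));
  rewrite sS' in realV.
have E6 : P`_6 = 11%:R * l ^+ 5 by rewrite l5; field.
have E1 : P`_1 = - l ^+ 10.
  have -> : P`_1 = - P`_6 ^+ 2 / 121%:R by rewrite rel; field.
  by rewrite E6; field.
have [E0 E2 E3 E4] : [/\ P`_0 = 0, P`_2 = 0, P`_3 = 0 & P`_4 = 0].
  by split; apply: c0.
have [E5 E7 E8 E9 E10] : [/\ P`_5 = 0, P`_7 = 0, P`_8 = 0, P`_9 = 0 & P`_10 = 0].
  by split; apply: c0.
apply: realV => //.
- apply: root_poly_eq => [|i].
    rewrite sS' size_polyDl size_polyXn //.
    rewrite (leq_ltn_trans (size_polyD _ _)) // gtn_max size_polyN size_polyX andbT.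
    by rewrite (leq_ltn_trans (size_scale_leq _ _)) // size_polyXn.
  rewrite sS' root_poly_scale // sS -/P !coefE.
  case: i => [|[|[|[|[|[|[|[|[|[|[|[|//]]]]]]]]]]]] _ /=;
    rewrite ?(E0, E1, E2, E3, E4, E5, E6, E7, E8, E9, E10, P11);
    rewrite ?(raddfD, raddfB, raddf0, rmorphM, rmorph1, rmorph_nat) /=; by field.
- by rewrite !coefE.
- by rewrite !coefE.
Qed.

(** * Arbitrary finite subgroups *)

Lemma conj_realizable (Gamma : set (PGL2 algC)) :
  finite_subgroup Gamma -> exists h, realizable (conjset Gamma h).
Proof.
move=> fG; have sG := finite_subgroup_subgroup fG; have [G1 _ _] := sG.
have [nontrivial|trivial] := pselect (exists2 g, Gamma g & g != 1%g); last first.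
  (* The trivial group has no point with nontrivial stabilizer; it is the group of homotheties with
     n = 1. *)
  exists 1%g; rewrite conjset1.
  suff -> : Gamma = homotheties 1 by apply: realizable_homotheties.
  apply/seteqP; split=> g.
    move=> Gg; exists 1; first by rewrite expr1n.
    by rewrite aff1; apply: contra_notP trivial => /eqP g1; exists g.
  by case=> a; rewrite expr1 => -> ->; rewrite aff1.
have [p [n [k [n1 dG kE]]]] := orbit_data_exists fG nontrivial.
have [h [dG' H]] := normalize_stab sG n1 dG.
have sG' := subgroup_conj h sG; have n0 : (0 < n)%N by apply: ltnW.
suff [h' rG] : exists h', realizable (conjset (conjset Gamma h) h').
  by exists (h * h')%g; rewrite -conjsetM.
case: kE => [k1|k2|].
- rewrite k1 in dG'; exists 1%g; rewrite conjset1 (one_point_orbit H sG' dG').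
  exact: realizable_homotheties.
- rewrite k2 in dG'; have [h' e] := two_point_orbit n1 H sG' dG'.
  by exists h'; rewrite e; apply: realizable_dihedral.
have [S VF sS] := orbit_vertex_figure sG' H dG'.
rewrite !inE => /or3P[] /eqP[nE kE]; subst n k.
- exact: tetrahedral VF sS.
- exact: octahedral VF sS.
- exact: icosahedral VF sS.
Qed.

Local Close Scope ring_scope.

Theorem theorem1p3 (Gamma : set (PGL2 algC)) (hGamma : finite_subgroup Gamma) :
  exists f : endoP1 algC,
    [/\ 2 <= degree f,
        defined_over (ratr : {rmorphism rat -> algC}) f
      & conjugate (Aut f) Gamma].
Proof.
have [h [f [df fQ fA]]] := conj_realizable hGamma.
by exists f; split=> //; exists h.
Qed.
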